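(* Let $W$ be an irreducible, finite Coxeter group with reflection arrangement $\mathcal{A}$ and let $X$ and $Y$ be two flats in the intersection lattice $\mathcal{L}_{\mathcal{A}}$ such that $\dim(X)=\dim(Y)+1$. Then the set $\mathcal{G}([X])_{[Y]}$, which consists of the parabolic subgroups of $W$ of type $[Y]$ that are of full support and have core of parabolic type $[X]$, has size given by the formula $$\Big|\mathcal{G}\big([X]\big)_{[Y]}\Big|=\frac{2\cdot u_{[X],[Y]}}{[N(X):W_X]}\cdot\prod_{i=2}^{\dim(X)}(b_i^X-1),$$ where $N(X)$ and $W_X$ are respectively the setwise and pointwise stabilizers of $X$ in $W$, the $b_i^X$ denote the Orlik-Solomon exponents of the restricted arrangement $\mathcal{A}^X$, and the Orlik-Solomon number $u_{[X],[Y]}$ is the number of hyperplanes in $\mathcal{A}^X$ of parabolic type $[Y]$.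
   Context: A finite Coxeter group $W$ with set of simple generators $S$, $n=|S|$, acts on $V\cong\mathbb{R}^n$ by its natural (geometric, essential) orthogonal reflection representation. The reflection arrangement $\mathcal{A}$ is the set of fixed hyperplanes of the reflections of $W$. The intersection lattice $\mathcal{L}_{\mathcal{A}}$ is the set of all intersections of hyperplanes of $\mathcal{A}$ (including $V$ itself), ordered by reverse inclusion; its elements are called flats. For a flat $X$, the restricted arrangement is $\mathcal{A}^X=\{H\cap X : H\in\mathcal{A},\ H\not\supseteq X\}$, an arrangement of hyperplanes in $X$. Parabolic subgroups of $W$ are the pointwise stabilizers $W_X$ of flats $X$; the map $X\mapsto W_X$ is a bijection between flats and parabolic subgroups. Standard parabolic subgroups are the subgroups $\langle J\rangle$ for $J\subseteq S$. $W$ acts on flats (equivalently, by conjugation on parabolic subgroups), and the orbit $[X]\in\mathcal{L}_{\mathcal{A}}/W$ of $X$ is called the parabolic type of $X$ and of $W_X$. For a parabolic subgroup $W'$ of $W$ there are unique subsets $I,J\subseteq S$ with $\langle I\rangle\le W'\le\langle J\rangle$ such that $I$ is the maximum and $J$ the minimum subset with this property. $I$ is called the core and $J$ the support of $W'$; $W'$ is of full support if $J=S$. The core $I$ is said to be of parabolic type $[X]$ if the subgroup $\langle I\rangle$ is. The number $u_{[X],[Y]}$ equals $\#\{Z\in[Y]: Z\subseteq X\}$ for a fixed representative $X$ of $[X]$. The Orlik-Solomon exponents $b_1^X\le b_2^X\le\cdots\le b_{\dim X}^X$ are the positive integers (known to exist, with $b_1^X=1$) such that $\chi(\mathcal{A}^X,t)=\prod_{i=1}^{\dim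 X}(t-b_i^X)$, where the characteristic polynomial is $\chi(\mathcal{A}^X,t)=\sum_{Z}\mu(X,Z)\,t^{\dim Z}$, summed over flats $Z\subseteq X$ of $\mathcal{A}^X$, with $\mu$ the Möbius function of the intersection lattice of $\mathcal{A}^X$ (ordered by reverse inclusion).
   Formalization: The formal theorem assumes dim(Y) ≥ 1: for Y={0} the only parabolic subgroup of type [Y] is W, whose core S is not of type [X], so the left side is 0 while the right side 2/[N(X):W_X] is positive (e.g. type A_1, X=V). *)

(* Defs.v *)
From HB Require Import structures.
From mathcomp Require Export all_boot all_order all_algebra all_fingroup.
From mathcomp Require Export mxrepresentation finmap reals trigo.

Set Implicit Arguments.
Unset Strict Implicit.
Unset Printing Implicit Defensive.

Export GRing.Theory Num.Theory.

Local Open Scope ring_scope.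
Local Open Scope fset_scope.

Section CoxeterSystem.

Variables (gT : finGroupType) (S : {set gT}).

(* (W, S) is presented by the relations (s t)^m(s, t) = 1, where m(s, t) is the
   order of s t; all these orders are finite because W is.  The case s = t
   gives the relation s ^ 2 = 1. *)
Definition coxeter_system : Prop :=
  [/\ <<S>>%g = [set: gT],
      forall s, s \in S -> #[s]%g = 2%N
    & forall (H : groupType) (f : gT -> H),
        (forall s t, s \in S -> t \in S ->
           ((f s * f t) ^+ #[(s * t)%g]%g = 1)%g) ->
        exists2 phi : gT -> H,
          {morph phi : x y / (x * y)%g} & {in S, phi =1 f}].

Definition coxeter_graph : rel gT :=
  [rel s t | [&& s \in S, t \in S & (2 < #[(s * t)%g]%g)%N]].

Definition irreducible_coxeter : Prop :=
  S != set0 /\ {in S &, forall s t, connect coxeter_graph s t}.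

Definition reflections : {set gT} := class_support S [set: gT].

Definition is_core (W' I : {set gT}) : bool :=
  [&& I \subset S, <<I>>%g \subset W'
    & [forall K : {set gT},
         (K \subset S) && (<<K>>%g \subset W') ==> (K \subset I)]].

Definition is_support (W' J : {set gT}) : bool :=
  [&& J \subset S, W' \subset <<J>>%g
    & [forall K : {set gT},
         (K \subset S) && (W' \subset <<K>>%g) ==> (J \subset K)]].

End CoxeterSystem.

Section Arrangements.

Variables (K : fieldType) (vT : vectType K).
Implicit Types (A L : {fset {vspace vT}}) (E X Z U : {vspace vT}).

(* E is the ambient space of A; the empty intersection is E. *)
Definition intersection_lattice E A : {fset {vspace vT}} :=
  [fset (E :&: \bigcap_(H <- B) H)%VS
    | B : {fset {vspace vT}} in fpowerset A].

Definition restriction A X : {fset {vspace vT}} :=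
  [fset (H :&: X)%VS | H in A & ~~ (X <= H)%VS].

Fixpoint mobius_rec L X (k : nat) Z : int :=
  if k is k'.+1 then
    if Z == X then 1
    else - \sum_(U <- L | [&& (U <= X)%VS, (Z <= U)%VS & U != Z])
             mobius_rec L X k' U
  else 0.

(* Moebius function of L ordered by reverse inclusion, for the interval from X
   down to Z.  The recursion depth suffices because dim U > dim Z in the recursive calls;
   see mobiusE. *)
Definition mobius L X Z : int := mobius_rec L X (\dim X - \dim Z).+1 Z.

Lemma mobius_rec_depth L X k Z : (\dim X - \dim Z < k)%N ->
  mobius_rec L X k Z = mobius L X Z.
Proof.
rewrite /mobius.
have aux d : forall k1 k2 Z', (\dim X - \dim Z' <= d)%N ->
    (\dim X - \dim Z' < k1)%N -> (\dim X - \dim Z' < k2)%N ->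
    mobius_rec L X k1 Z' = mobius_rec L X k2 Z'.
  elim: d => [|d IHd] [|k1] [|k2] Z' //= led lt1 lt2; case: eqP => // _;
    congr (- _); apply: eq_bigr => U /and3P[UX ZU neqUZ];
    have ltZU : (\dim Z' < \dim U)%N by
      rewrite (ltn_leqif (dimv_leqif_eq ZU)) eq_sym.
    by have := leq_trans ltZU (dimvS UX); rewrite -subn_gt0 ltnNge led.
  have ltd : (\dim X - \dim U < \dim X - \dim Z')%N.
    by apply: ltn_sub2l => //; apply: leq_trans ltZU (dimvS UX).
  by apply: IHd; [rewrite -ltnS | apply: leq_trans ltd _..];
     first exact: leq_trans ltd led.
by move=> ltk; apply: aux (leqnn _) ltk (ltnSn _).
Qed.

Lemma mobiusE L X Z : mobius L X Z =
  if Z == X then 1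
  else - \sum_(U <- L | [&& (U <= X)%VS, (Z <= U)%VS & U != Z])
           mobius L X U.
Proof.
rewrite {1}/mobius /=; case: eqP => // _; congr (- _).
apply: eq_bigr => U /and3P[UX ZU neqUZ]; apply: mobius_rec_depth.
have ltZU : (\dim Z < \dim U)%N by
  rewrite (ltn_leqif (dimv_leqif_eq ZU)) eq_sym.
by apply: ltn_sub2l => //; apply: leq_trans ltZU (dimvS UX).
Qed.

Definition char_poly_arr E A : {poly int} :=
  let L := intersection_lattice E A in
  \sum_(Z <- L) mobius L E Z *: 'X^(\dim Z).

End Arrangements.

Section GeometricRepresentation.

Variables (R : realType) (gT : finGroupType) (S : {set gT}).

Notation V := ('rV[R]_#|S|).

Definition coxeter_form : 'M[R]_#|S| :=
  \matrix_(i, j) - cos (pi / #[(enum_val i * enum_val j)%g]%g%:R).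

Variable rG : mx_representation R [set: gT] #|S|.

(* The i-th unit vector is the simple root of enum_val i.  W acts on row
   vectors from the right; as the generators are involutions, this is the usual
   left action precomposed with inversion. *)
Definition geometric_representation : Prop :=
  forall (i : 'I_#|S|) (v : V),
    v *m rG (enum_val i) =
    v - (2 * (v *m coxeter_form) 0 i) *: delta_mx 0 i.

Definition repr_end (w : gT) : 'End(V) := linfun (mulmxr (rG w)).

Definition translate (w : gT) (X : {vspace V}) : {vspace V} :=
  (repr_end w @: X)%VS.

Definition reflection_arrangement : {fset {vspace V}} :=
  [fset fixedSpace (repr_end t) | t in reflections S].

Definition flats : {fset {vspace V}} :=
  intersection_lattice fullv reflection_arrangement.

Definition pointwise_stab (X : {vspace V}) : {set gT} :=
  [set w | X <= fixedSpace (repr_end w)]%VS.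

Definition setwise_stab (X : {vspace V}) : {set gT} :=
  [set w | translate w X == X].

Definition orbit_flat (X : {vspace V}) : {fset {vspace V}} :=
  [fset translate w X | w in [set: gT]].

Definition of_parabolic_type (X : {vspace V}) (W' : {set gT}) : bool :=
  has (fun Z => W' == pointwise_stab Z) (orbit_flat X).

Definition orlik_solomon_number (X Y : {vspace V}) : nat :=
  #|` [fset Z in orbit_flat Y | (Z <= X)%VS] |.

Definition orlik_solomon_exponents (X : {vspace V}) (b : seq nat) : Prop :=
  [/\ size b = \dim X, sorted leq b, all (leq 1) b
    & char_poly_arr X (restriction reflection_arrangement X) =
      \prod_(c <- b) ('X - (c%:Z)%:P)].

Definition full_support_with_core (X Y : {vspace V}) : {set {set gT}} :=
  [set W' | [&& of_parabolic_type Y W', is_support S W' S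
              & [exists I : {set gT},
                   is_core S W' I && of_parabolic_type X <<I>>%g]]].

End GeometricRepresentation.

(* Main.v *)
(* Let C be the closed fundamental chamber; its faces are spanned by sets of
   fundamental weights omega_j.  A parabolic subgroup W_Z has full support iff
   Z contains no omega_j, and its core is generated by the walls of C through Z,
   so |G([X])_[Y]| counts pairs (F, Z) where F is a face of C whose span is
   W-conjugate to X and Z is a flat of type [Y] that is a hyperplane of the span
   of F and meets F only in 0.  Every chamber of A^X is W-conjugate to exactly one
   face of C, and N(X)/W_X acts freely on these chambers, so [N(X) : W_X] times
   the number of pairs is the sum, over the Z of type [Y] in X, of the number N(Z)
   of chambers of A^X meeting Z only in 0.

   Let h(T) be the sum of (-1)^dim F over all faces F in a flat T that meet Z
   only in 0.  Then (-1)^dim X N(Z) = sum_T mu(X,T) h(T) by Moebius inversion.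
   Clearly h(T) = 1 if T is contained in Z.  Otherwise push every face in the
   direction z + delta y, with z generic in T /\ Z and y in T \ Z: grouping the
   faces by the chamber of T they are pushed into, simpliciality of the chambers
   makes all groups cancel except one, and h(T) = -1.  Hence
   (-1)^dim X N(Z) = -2 sum_(T not in Z) mu(X,T), which by Weisner's theorem is
   -2 chi'(1), that is N(Z) = 2 prod_(i >= 2) (b_i - 1).

   That C is a strict fundamental domain is Tits's theorem.  Its proof only needs
   the orders of the products of two generators, and finiteness of W gives the
   nondegeneracy of the bilinear form. *)

Require Import Defs.
From mathcomp Require Import zify ring lra boolp.
Import Order.TTheory.

Set Implicit Arguments.
Unset Strict Implicit.
Unset Printing Implicit Defensive.

Local Open Scope ring_scope.

(** * Signs, Moebius functions and characteristic polynomials *)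

(** Each positive value bounds the admissible step, and finitely many such bounds have a positive
    minimum. *)
Lemma small_perturbation (R : realFieldType) (s : seq (R * R)) :
  exists2 e : R, 0 < e & {in s, forall p, 0 < p.1 -> 0 < p.1 + e * p.2}.
Proof.
suff [e e0 he] : exists2 e : R, 0 < e &
    forall d, 0 < d -> d <= e -> {in s, forall p, 0 < p.1 -> 0 < p.1 + d * p.2}.
  by exists e => //; apply: he.
elim: s => [|[u v] s [e e0 he]]; first by exists 1.
case: (lerP u 0) => [u0|u0].
  exists e => // d d0 de p; rewrite inE => /predU1P[-> /= | ps]; last exact: he.
  by rewrite ltNge u0.
have v1 : 0 < `|v| + 1 by rewrite ltr_wpDl.
(* The summand 1 guards against a zero slope; the factor 2 keeps the perturbed value strictly
   positive. *)
exists (Num.min e (u / (2 * (`|v| + 1)))).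
  by rewrite lt_min e0 divr_gt0 // mulr_gt0.
move=> d d0; rewrite le_min => /andP[de du] p.
rewrite inE => /predU1P[-> /= _ | ps]; last exact: he.
move: du; rewrite ler_pdivlMr ?mulr_gt0 // => du.
have : `|d * v| <= d * (`|v| + 1) by rewrite normrM (gtr0_norm d0) ler_pM2l // lerDl.
have := lerNnormlW (lexx `|d * v|).
lra.
Qed.

(** If [A] is a proper subset of [C], toggling an element of [C] outside [A] reverses signs; if [A]
    is not contained in [C], the sum is empty. *)
Lemma sum_sign_subset_interval (T : finType) (A C : {set T}) :
  \sum_(D : {set T} | (A \subset D) && (D \subset C)) (-1) ^+ #|D| =
  (if A == C then (-1) ^+ #|A| else 0) :> int.
Proof.
case: eqVneq => [->|AC].
  by rewrite (big_pred1 C) // => D; rewrite -eqEsubset eq_sym.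
have [sAC|nAC] := boolP (A \subset C); last first.
  rewrite big_pred0 // => D; apply: contraNF nAC => /andP[].
  exact: subset_trans.
have /subsetPn[x xC xA] : ~~ (C \subset A).
  by apply: contra AC => CA; rewrite eqEsubset sAC.
rewrite (bigID [pred D : {set T} | x \in D]) /=.
rewrite (reindex_onto (fun D => x |: D) (fun D => D :\ x)) /=; last first.
  by move=> D /andP[_ xD]; rewrite setD1K.
under eq_bigl => D.
  have -> : (A \subset x |: D) && (x |: D \subset C) && (x \in x |: D)
              && ((x |: D) :\ x == D) = ((A \subset D) && (D \subset C)) && (x \notin
                D).
    rewrite setU11 subUset sub1set xC /=.
    have -> : ((x |: D) :\ x == D) = (x \notin D).
      apply/eqP/idP => [<-|xD]; first by rewrite !inE eqxx.
      by rewrite setU1K.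
    case: (boolP (x \in D)) => [|xD]; rewrite ?andbF // !andbT; congr (_ && _).
    apply/idP/idP => [/subsetP AD|AD]; last exact: subset_trans AD (subsetUr _ _).
    apply/subsetP => y yA; have := AD y yA; rewrite !inE => /predU1P[yx|//].
    by rewrite -yx yA in xA.
  over.
rewrite -big_split big1 //= => D /andP[_ xD].
by rewrite cardsU1 xD exprS mulN1r addNr.
Qed.

Lemma bigD1_seq_cond (M : nmodType) (I : eqType) (r : seq I) (P : pred I) j
    (F : I -> M) : j \in r -> uniq r -> P j ->
  \sum_(i <- r | P i) F i = F j + \sum_(i <- r | P i && (i != j)) F i.
Proof.
move=> jr ur Pj; rewrite big_mkcond (bigD1_seq j) //= Pj; congr (_ + _).
by rewrite -big_mkcondr; apply: eq_bigl => i; rewrite andbC.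
Qed.

Section Weisner.

Variables (K : fieldType) (vT : vectType K).
Implicit Types (L : {fset {vspace vT}}) (X Z U T : {vspace vT}).

Lemma sum_mobius_eq0 L X U : U \in L -> (U <= X)%VS -> U != X ->
  \sum_(T <- L | (U <= T)%VS && (T <= X)%VS) mobius L X T = 0.
Proof.
move=> UL UX nUX; rewrite (bigD1_seq_cond (j := U)) ?fset_uniq //= ?subvv ?UX //.
rewrite mobiusE (negPf nUX); apply/eqP; rewrite addrC subr_eq0; apply/eqP.
by apply: eq_bigl => T; rewrite andbA [in RHS](andbC (T <= X)%VS).
Qed.

Lemma mobius_top L X : mobius L X X = 1.
Proof. by rewrite mobiusE eqxx. Qed.

Variables (L : {fset {vspace vT}}) (X Z : {vspace vT}).
Hypothesis LX : {in L, forall T, T <= X}%VS.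
Hypotheses (XL : X \in L) (ZL : Z \in L) (ZX : Z != X).
Hypothesis LZ : {in L, forall T, (T :&: Z)%VS \in L}.
Notation mu := (mobius L X).

(** Under reverse inclusion [T :&: Z] is the join. The sum of [mu] over all [T] containing [U]
    vanishes; when it is split by the value of [T :&: Z], the part of every value other than [U]
    vanishes by induction. *)
Lemma weisner U : U \in L -> (U <= Z)%VS ->
  \sum_(T <- L | (T :&: Z)%VS == U) mu T = 0.
Proof.
move=> UL UZ; have [n] := ubnP (\dim Z - \dim U).
elim: n U UL UZ => // n IH U UL UZ /ltnSE len.
have UX : U != X.
  by apply: contraNneq ZX => UX; apply/eqP/subv_anti; rewrite LX //= -UX.
have := sum_mobius_eq0 UL (LX UL) UX.
rewrite big_mkcond /=.
rewrite (eq_big_seq (fun T => \sum_(U' <- L | (U <= U')%VS && (U' <= Z)%VS)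
      if (T :&: Z)%VS == U' then mu T else 0)); last first.
  move=> T TL /=; rewrite (LX TL) andbT; case: ifP => UT.
    rewrite (bigD1_seq_cond (j := (T :&: Z)%VS)) ?fset_uniq ?LZ //= ?eqxx ?subv_cap
      ?UT ?UZ ?capvSr //.
    by rewrite big1 ?addr0 // => U' /andP[_]; rewrite eq_sym => /negPf->.
  rewrite big1 // => U' /andP[UU' U'Z]; case: eqP => // TZ.
  by rewrite -TZ subv_cap UT in UU'.
rewrite exchange_big /= (bigD1_seq_cond (j := U)) ?fset_uniq //= ?subvv ?UZ //.
rewrite -big_mkcond /= [X in _ + X = _]big1_seq ?addr0 //.
move=> U' /andP[/andP[/andP[UU' U'Z] nUU'] U'L].
rewrite -big_mkcond /=; apply: IH => //.
apply: leq_trans len; apply: ltn_sub2l; last first.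
  by rewrite (ltn_leqif (dimv_leqif_eq UU')) eq_sym.
by apply: leq_trans (dimvS U'Z); rewrite (ltn_leqif (dimv_leqif_eq UU')) eq_sym.
Qed.

(** By Weisner's theorem the sum of [mu T] times the dimension of [T :&: Z] is zero, and [\dim T]
    exceeds that dimension by one exactly off [Z]. The left side is the derivative at 1 of the
    characteristic polynomial. *)
Lemma sum_mobius_dim :
  (forall T, T \in L -> ~~ (T <= Z)%VS -> \dim T = (\dim (T :&: Z)).+1) ->
  \sum_(T <- L) mu T * (\dim T)%:Z = \sum_(T <- L | ~~ (T <= Z)%VS) mu T.
Proof.
move=> dimZ.
have cap0 : \sum_(T <- L) mu T * (\dim (T :&: Z))%:Z = 0.
  rewrite (eq_big_seq (fun T => \sum_(U <- L | (U <= Z)%VS)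
     if (T :&: Z)%VS == U then mu T * (\dim U)%:Z else 0)); last first.
    move=> T TL /=;
      rewrite (bigD1_seq_cond (j := (T :&: Z)%VS)) ?fset_uniq ?LZ ?capvSr //=.
    by rewrite eqxx big1 ?addr0 // => U /andP[_]; rewrite eq_sym => /negPf->.
  rewrite exchange_big big1_seq //= => U /andP[UZ UL].
  by rewrite -big_mkcond -mulr_suml weisner // mul0r.
rewrite [RHS]big_mkcond -[RHS]add0r -[X in _ = X + _]cap0 -big_split /=.
apply: eq_big_seq => T TL; case: ifPn => [TZ|];
  first by rewrite dimZ // -addn1 PoszD mulrDr mulr1.
by rewrite negbK => /capv_idPl->; rewrite addr0.
Qed.

End Weisner.

(** Some factor vanishes, so 1 occurs in [b]; being the least possible entry, it comes first. *)
Lemma nat_root_first (b : seq nat) : sorted leq b -> all (leq 1) b ->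
  \prod_(c <- b) (1 - c%:Z) = 0 :> int -> exists b', b = 1%N :: b'.
Proof.
move=> sb b1 /eqP; rewrite prodf_seq_eq0 => /hasP[c cb].
rewrite subr_eq0 => /eqP [c1]; rewrite -{c}c1 in cb.
case: b sb b1 cb => // d b' /= sb /andP[d1 _].
rewrite inE => /predU1P[<-|b'1]; first by exists b'.
exists b'; congr (_ :: _).
have /allP/(_ 1%N b'1) := order_path_min leq_trans sb.
by move: d1; clear; case: d => [|[]].
Qed.

Lemma deriv_prod_at1 (b' : seq nat) :
  (\prod_(c <- 1%N :: b') ('X - (c%:Z)%:P))^`().[1] = \prod_(c <- b') (1 - c%:Z) :> int.
Proof.
rewrite big_cons derivM derivXsubC mul1r hornerD hornerM hornerXsubC.
rewrite -[X in 1 - X]/(1 : int) subrr mul0r addr0.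
by rewrite horner_prod; apply: eq_bigr => c _; rewrite !hornerE.
Qed.

(** * The geometric representation *)

Section CoxeterGeometry.

Variables (R : realType) (gT : finGroupType) (S : {set gT}).
Variable rG : mx_representation R [set: gT] #|S|.
Hypothesis genW : <<S>>%g = [set: gT].
Hypothesis invS : forall s, s \in S -> #[s]%g = 2%N.
Hypothesis geo : geometric_representation rG.

Notation V := ('rV[R]_#|S|).
Notation B := (coxeter_form R S).
Implicit Types (i j : 'I_#|S|) (w u v : gT) (x y z : V).

Definition gen i : gT := enum_val i.
Definition act x w : V := x *m rG w.
(* phi i is B(-, alpha_i), whose kernel is the reflecting hyperplane of gen i. *)
Definition phi i x : R := (x *m B) 0 i.
Definition alpha i : V := delta_mx 0 i.

Lemma actD x y w : act (x + y) w = act x w + act y w.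
Proof. exact: mulmxDl. Qed.
Lemma actZ a x w : act (a *: x) w = a *: act x w.
Proof. by rewrite /act scalemxAl. Qed.
Lemma actN x w : act (- x) w = - act x w.
Proof. exact: mulNmx. Qed.
Lemma act0 w : act 0 w = 0.
Proof. exact: mul0mx. Qed.
Lemma act_sum I (r : seq I) (P : pred I) (F : I -> V) w :
  act (\sum_(i <- r | P i) F i) w = \sum_(i <- r | P i) act (F i) w.
Proof. exact: mulmx_suml. Qed.
Lemma act1 x : act x 1%g = x.
Proof. by rewrite /act repr_mx1 mulmx1. Qed.
Lemma actM x w u : act x (w * u)%g = act (act x w) u.
Proof. by rewrite /act repr_mxM ?inE// mulmxA. Qed.
Lemma actK w : cancel (act^~ w) (act^~ w^-1%g).
Proof. by move=> x; rewrite -actM mulgV act1. Qed.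
Lemma actKV w : cancel (act^~ w^-1%g) (act^~ w).
Proof. by move=> x; rewrite -actM mulVg act1. Qed.

Lemma phiD i x y : phi i (x + y) = phi i x + phi i y.
Proof. by rewrite /phi mulmxDl mxE. Qed.
Lemma phiZ i a x : phi i (a *: x) = a * phi i x.
Proof. by rewrite /phi -scalemxAl mxE. Qed.
Lemma phi0 i : phi i 0 = 0.
Proof. by rewrite /phi mul0mx mxE. Qed.
Lemma phi_sum I (r : seq I) (P : pred I) (F : I -> V) i :
  phi i (\sum_(k <- r | P k) F k) = \sum_(k <- r | P k) phi i (F k).
Proof. by rewrite /phi mulmx_suml summxE. Qed.

Lemma phi_alpha i j : phi j (alpha i) = B i j.
Proof. by rewrite /phi /alpha -rowE mxE. Qed.

Lemma genP i : gen i \in S.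
Proof. exact: enum_valP. Qed.
Lemma gen_surj s : s \in S -> exists i, s = gen i.
Proof. by move=> sS; exists (enum_rank_in sS s); rewrite /gen enum_rankK_in. Qed.
Lemma gen2 i : (gen i * gen i = 1)%g.
Proof. by rewrite -expg2 -(invS (genP i)) expg_order. Qed.
Lemma genV i : ((gen i)^-1 = gen i)%g.
Proof. by apply/eqP; rewrite eq_invg_mul gen2. Qed.
Lemma genK i w : (gen i * (gen i * w) = w)%g.
Proof. by rewrite mulgA gen2 mul1g. Qed.
Lemma gen_inj : injective gen.
Proof. exact: enum_val_inj. Qed.

Lemma act_gen i x : act x (gen i) = x - (2 * phi i x) *: alpha i.
Proof. exact: geo. Qed.

Lemma formC i j : B i j = B j i.
Proof.
rewrite !mxE -/(gen i) -/(gen j); congr (- cos (_ / _%:R)).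
by rewrite -orderV invMg !genV.
Qed.

Lemma form1 i : B i i = 1.
Proof. by rewrite mxE -/(gen i) gen2 order1 divr1 cospi opprK. Qed.

Lemma act_alpha_gen i : act (alpha i) (gen i) = - alpha i.
Proof. by rewrite act_gen phi_alpha form1 mulr1 scaler_nat mulr2n opprD addNKr. Qed.

Lemma phi_gen i x : phi i (act x (gen i)) = - phi i x.
Proof.
by rewrite act_gen phiD -scaleNr phiZ phi_alpha form1; ring.
Qed.

Lemma alpha_basis x : x = \sum_j x 0 j *: alpha j.
Proof. exact: row_sum_delta. Qed.

Lemma phiE i x : phi i x = \sum_j x 0 j * B j i.
Proof. by rewrite {1}[x]alpha_basis phi_sum; apply: eq_bigr => j _;
  rewrite phiZ phi_alpha. Qed.

(** The form with Gram matrix [B] on the simple roots, which [bil_act] shows to be invariant. *)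
Definition bil x y : R := \sum_i y 0 i * phi i x.

Lemma bilC x y : bil x y = bil y x.
Proof.
rewrite /bil.
under eq_bigr do rewrite phiE mulr_sumr.
rewrite exchange_big /=; apply: eq_bigr => i _; rewrite phiE mulr_sumr.
by apply: eq_bigr => j _; rewrite formC; ring.
Qed.

Lemma bilDl x x' y : bil (x + x') y = bil x y + bil x' y.
Proof. by rewrite /bil -big_split; apply: eq_bigr => i _; rewrite phiD mulrDr. Qed.
Lemma bilZl a x y : bil (a *: x) y = a * bil x y.
Proof. by rewrite /bil mulr_sumr; apply: eq_bigr => i _; rewrite phiZ mulrCA. Qed.
Lemma bil_alpha x i : bil x (alpha i) = phi i x.
Proof.
rewrite /bil (bigD1 i) //= big1 => [|j ji]; last first.
  by rewrite /alpha mxE /= (negPf ji) mul0r.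
by rewrite /alpha mxE !eqxx mul1r addr0.
Qed.

Lemma bil_gen x y i : bil (act x (gen i)) (act y (gen i)) = bil x y.
Proof.
rewrite !act_gen -!scaleNr !(bilDl, bilZl) 2!(bilC _ (y + _)) !(bilDl, bilZl).
by rewrite (bilC (alpha i) x) !bil_alpha phi_alpha form1 (bilC y x); ring.
Qed.

Lemma gen_ind (P : gT -> Prop) :
  P 1%g -> (forall i w, P w -> P (gen i * w)%g) -> forall w, P w.
Proof.
move=> P1 PM w.
have: w \in <<S>>%g by rewrite genW inE.
case/gen_prodgP => k [c cS ->].
elim: k c cS => [|k IH] c cS; first by rewrite big_ord0.
rewrite big_ord_recl; have [i ->] := gen_surj (cS ord0).
by apply: PM; apply: IH => j; apply: cS.
Qed.

Lemma bil_act x y w : bil (act x w) (act y w) = bil x y.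
Proof.
elim/gen_ind: w x y => [|i w IH] x y; first by rewrite !act1.
by rewrite !actM IH bil_gen.
Qed.

(** By invariance, [phi i] after [w] is the pairing with the root [alpha i] moved by [w^-1], so the
    signs of root coordinates control the signs of [phi]. *)
Lemma phi_act i x w : phi i (act x w) = \sum_j act (alpha i) w^-1 0 j * phi j x.
Proof. by rewrite -bil_alpha -(bil_act _ _ w^-1%g) actK. Qed.

(** A generator negates its simple root, so summing over the group kills every simple root and hence
    every vector, whereas a fixed vector is only multiplied by the group order. *)
Lemma fixed_eq0 x : (forall w, act x w = x) -> x = 0.
Proof.
move=> fx.
have sum0 y : \sum_w act y w = 0.
  suff al0 i : \sum_w act (alpha i) w = 0.
    rewrite [y]alpha_basis; under eq_bigr do rewrite act_sum.
    rewrite exchange_big big1 //= => i _.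
    by under eq_bigr do rewrite actZ; rewrite -scaler_sumr al0 scaler0.
  have: \sum_w act (alpha i) w = - \sum_w act (alpha i) w.
    rewrite {1}(reindex_inj (mulgI (gen i))) /= -sumrN.
    by apply: eq_bigr => w _; rewrite actM act_alpha_gen actN.
  move/eqP; rewrite -subr_eq0 opprK -mulr2n -scaler_nat scaler_eq0.
  by rewrite pnatr_eq0 /= => /eqP.
have := sum0 x; rewrite (eq_bigr (fun=> x)) => [|w _]; last exact: fx.
rewrite sumr_const -scaler_nat => /eqP; rewrite scaler_eq0 pnatr_eq0.
have /card_gt0P : exists w : gT, w \in [set: gT] by exists 1%g.
by rewrite cardsT lt0n => /negPf -> /= /eqP.
Qed.

(** A vector in the radical of the form is fixed by every generator, hence zero. *)
Lemma phi_inj x : (forall i, phi i x = 0) -> x = 0.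
Proof.
move=> x0; apply: fixed_eq0 => w; elim/gen_ind: w => [|i w IH]; first exact: act1.
by rewrite actM act_gen x0 mulr0 scale0r subr0.
Qed.

Lemma form_unit : B \in unitmx.
Proof.
rewrite -row_free_unit -kermx_eq0; apply/rowV0P => x /sub_kermxP xB.
by apply: phi_inj => i; rewrite /phi xB mxE.
Qed.

(** The fundamental weights: the basis dual to the functionals [phi]. *)
Definition omega j : V := row j (invmx B).

Lemma phi_omega i j : phi i (omega j) = (i == j)%:R.
Proof. by rewrite /phi /omega -row_mul mulVmx ?form_unit // !mxE eq_sym. Qed.

Lemma omega_basis x : x = \sum_j phi j x *: omega j.
Proof.
apply/eqP; rewrite -subr_eq0; apply/eqP/phi_inj => i.
rewrite -scaleN1r phiD phiZ phi_sum (bigD1 i) //= big1 => [|j ji].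
  by rewrite phiZ phi_omega eqxx mulr1 addr0 mulN1r subrr.
by rewrite phiZ phi_omega eq_sym (negPf ji) mulr0.
Qed.

(* The sum of the coordinates decreases by 2 phi_i under the i-th generator, so
   a maximiser over the orbit lies in the closed chamber. *)
Lemma to_chamber x : exists w, forall i, 0 <= phi i (act x w).
Proof.
pose psi y : R := \sum_j y 0 j.
have psi_gen i y : psi (act y (gen i)) = psi y - 2 * phi i y.
  rewrite act_gen /psi.
  under eq_bigr do rewrite !mxE.
  rewrite sumrB; congr (_ - _); rewrite (bigD1 i) //= !eqxx mulr1.
  by rewrite big1 ?addr0 // => j ji; rewrite (negPf ji) mulr0.
have [w _ wmax] := @Order.TotalTheory.arg_maxP _ _ gT 1%g predT
   (fun w => psi (act x w)) isT.
exists w => i; have := wmax (w * gen i)%g isT; rewrite actM psi_gen /=; lra.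
Qed.

(** * The fundamental chamber *)

Fixpoint alt (a b : gT) k : gT := if k is k'.+1 then (a * alt b a k')%g else 1%g.

Lemma altSr a b k : alt a b k.+1 = (alt a b k * (if odd k then b else a))%g.
Proof.
elim: k a b => [|k IH] a b; first by rewrite /= mulg1 mul1g.
rewrite -[alt a b k.+2]/(a * alt b a k.+1)%g IH /= mulgA.
by case: (odd k).
Qed.

(** For involutions, [alt a b k] times the inverse of [alt b a k] is the [k]-th power of [a * b]; at
    the order of [a * b] this becomes the braid relation. *)
Lemma alt_order a b : (a * a = 1)%g -> (b * b = 1)%g ->
  alt a b #[(a * b)%g]%g = alt b a #[(a * b)%g]%g.
Proof.
move=> a2 b2.
have key k : forall a b, (a * a = 1)%g -> (b * b = 1)%g ->
   (alt a b k * (alt b a k)^-1 = (a * b) ^+ k)%g.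
  elim: k => [|k IH] {a2 b2} {}a {}b a2 b2; first by rewrite /= invg1 mulg1 expg0.
  have bV : (b^-1 = b)%g by apply/eqP; rewrite eq_invg_mul b2.
  rewrite /= invMg mulgA -(mulgA a) IH // bV expgSr.
  elim: k {IH} => [|k IH]; first by rewrite !expg0 mulg1 mul1g.
  by rewrite expgS expgS -!mulgA; congr (a * (b * _))%g; rewrite !mulgA in IH *.
have /eqP := key #[(a * b)%g]%g a b a2 b2.
by rewrite expg_order -eq_mulgV1 => /eqP.
Qed.

Definition word (l : seq 'I_#|S|) : gT := (\prod_(i <- l) gen i)%g.

Lemma ex_word w : exists k, [exists l : k.-tuple 'I_#|S|, word l == w].
Proof.
suff [l wl]: exists l, word l = w.
  by exists (size l); apply/existsP; exists (in_tuple l); rewrite wl.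
elim/gen_ind: w => [|i w [l wl]]; first by exists [::]; rewrite /word big_nil.
by exists (i :: l); rewrite /word big_cons -/(word l) wl.
Qed.

Definition len w := ex_minn (ex_word w).

Lemma len_min l : (len (word l) <= size l)%N.
Proof.
rewrite /len; case: ex_minnP => m _; apply.
by apply/existsP; exists (in_tuple l).
Qed.

Lemma len_word w : exists2 l, word l = w & size l = len w.
Proof.
rewrite /len; case: ex_minnP => m /existsP[l /eqP <-] _.
by exists l => //; rewrite size_tuple.
Qed.

Lemma len_gen i w : (len (gen i * w) <= (len w).+1)%N.
Proof.
have [l <- <-] := len_word w.
by have := len_min (i :: l); rewrite /word big_cons.
Qed.

Lemma len0 w : len w = 0%N -> w = 1%g.
Proof. by have [[|i l] <- <-] := len_word w; rewrite /word ?big_nil. Qed.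

Lemma len_descent w k : len w = k.+1 -> exists i, (len (gen i * w) <= k)%N.
Proof.
have [[|i l] <- <-] //= := len_word w; case=> <-; exists i.
by rewrite /word big_cons genK len_min.
Qed.

Lemma len_alt i j k v : (len (alt (gen i) (gen j) k * v) <= k + len v)%N.
Proof.
elim: k i j => [|k IH] i j; first by rewrite mul1g.
by rewrite /= -mulgA (leq_trans (len_gen _ _)) // addSn ltnS IH.
Qed.

(** Each reflection advances the index by one, since sin(x + th) + sin(x - th) = 2 sin x cos th. The
    start [q] is arbitrary so that the induction on [k] goes through. *)
Lemma act_alt i j th k q : B i j = - cos th ->
  act (sin (q.+1%:R * th) *: alpha j + sin (q%:R * th) *: alpha i)
      (alt (gen i) (gen j) k)
  = sin ((q + k).+1%:R * th) *: alpha (if odd k then i else j)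
    + sin ((q + k)%:R * th) *: alpha (if odd k then j else i).
Proof.
elim: k i j q => [|k IH] i j q Bij; first by rewrite act1 addn0.
rewrite /= actM act_gen.
have -> : sin (q.+1%:R * th) *: alpha j + sin (q%:R * th) *: alpha i -
   (2 * phi i (sin (q.+1%:R * th) *: alpha j + sin (q%:R * th) *: alpha i)) *: alpha i
  = sin (q.+2%:R * th) *: alpha i + sin (q.+1%:R * th) *: alpha j.
  rewrite phiD !phiZ !phi_alpha form1 (formC j i) Bij.
  rewrite -addrA -scalerBl addrC; congr (_ *: _ + _).
  have -> : q.+2%:R * th = q.+1%:R * th + th by rewrite -addn1 natrD mulrDl mul1r.
  have -> : q%:R * th = q.+1%:R * th - th by rewrite -natr1 mulrDl mul1r addrK.
  by rewrite sinB sinD; ring.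
rewrite IH; last by rewrite formC.
by rewrite addSnnS; case: (odd k).
Qed.

(* Tits: write w = a v with a an alternating word in two generators and v minimal
   in its coset; below the order of the product, a sends the simple root to a
   combination with coefficients sin(k pi/m) >= 0. *)
Lemma root_pos_of_len i w : (len w <= len (gen i * w))%N ->
  forall k, 0 <= act (alpha i) w 0 k.
Proof.
have [n] := ubnP (len w); elim: n i w => // n IH s w /ltnSE lewn lesw k.
case: (posnP (len w)) => [/len0 -> | w_gt0].
  by rewrite act1 /alpha mxE; case: eqP => //=; case: eqP.
have [t let_] : exists t, (len (gen t * w) < len w)%N.
  by case lw: (len w) w_gt0 => [//|l] _; have [t] := len_descent lw; exists t.
have st : s != t by apply: contraTneq let_ => <-; rewrite -leqNgt.
pose m := #[(gen t * gen s)%g]%g.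
pose Q k := exists2 v, w = (alt (gen t) (gen s) k * v)%g & (len v + k <= len w)%N.
have Q1 : Q 1%N by exists (gen t * w)%g; rewrite /= ?mulg1 ?genK ?addn1.
(* A prefix of full length [m] could be rewritten by the braid relation to begin with [gen s],
   making [gen s * w] shorter than [w]. *)
have QmF : ~ Q m.
  case=> v wE lev; have m_gt0 : (0 < m)%N by apply: order_gt0.
  have swE : (gen s * w = alt (gen t) (gen s) m.-1 * v)%g.
    rewrite wE (alt_order (gen2 t) (gen2 s)) -/m -{1}(prednK m_gt0) /=.
    by rewrite -!mulgA genK.
  by have := len_alt t s m.-1 v; rewrite -swE; lia.
have [k0 [k0_gt0 [Qk0 nQk0]] k0m] : exists2 k, (0 < k)%N /\ Q k /\ ~ Q k.+1 & (k < m)%N.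
  apply: contrapT => h.
  have all_Q k' : (k' < m)%N -> Q k'.+1.
    elim: k' => [|k' IHk] // k'm; apply: contrapT => nQ; apply: h.
    by exists k'.+1 => //; do !split=> //; apply: IHk; apply: ltnW.
  have m_gt0 : (0 < m)%N by apply: order_gt0.
  by apply: QmF; have := all_Q m.-1; rewrite prednK // leqnn; apply.
case: Qk0 => v wE lev.
have lvn : (len v < n)%N by lia.
(* [p] is the last letter of the alternating word and [q] the next one. A descent of [v] along [q]
   would contradict the choice of [k0], one along [p] the length of [w]. *)
pose p := if odd k0 then t else s.
pose q := if odd k0 then s else t.
have geq : (if odd k0 then gen s else gen t) = gen q by rewrite /q; case: ifP.
have lq : (len v <= len (gen q * v))%N.
  rewrite leqNgt; apply/negP => lt; apply: nQk0.
  by exists (gen q * v)%g; [rewrite altSr geq -mulgA genK | lia].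
have lp : (len v <= len (gen p * v))%N.
  rewrite leqNgt; apply/negP => lt.
  case: k0 k0_gt0 {nQk0 k0m lq geq q} wE lev @p lt => // k1 _ wE lev p lt.
  have := len_alt t s k1 (gen p * v)%g.
  suff -> : (alt (gen t) (gen s) k1 * (gen p * v) = w)%g by lia.
  rewrite wE altSr -!mulgA; congr (_ * _)%g.
  by rewrite /p /=; case: (odd k1).
have hp := IH p v lvn lp k; have hq := IH q v lvn lq k.
pose th : R := pi / m%:R.
have m_gt1 : (1 < m)%N by apply: leq_ltn_trans k0m.
have m0 : 0 < (m%:R : R) by rewrite ltr0n; lia.
have sth : 0 < sin th.
  apply: sin_gt0_pi; rewrite /th divr_gt0 ?pi_gt0 //=.
  by rewrite ltr_pdivrMr // ltr_pMr ?pi_gt0 // ltr1n.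
have Bts : B t s = - cos th by rewrite mxE.
have sge c : (c <= m)%N -> 0 <= sin (c%:R * th).
  move=> cm; apply: sin_ge0_pi; rewrite /th mulr_ge0 ?ler0n ?divr_ge0 ?pi_ge0 //=.
  by rewrite mulrCA ler_piMr ?pi_ge0 // ler_pdivrMr // mul1r ler_nat.
(* Starting at index 0 leaves the single term in [alpha s], and [k0 < m] keeps both final angles in
   [0, pi]. *)
have := act_alt k0 0 Bts.
rewrite mul0r sin0 scale0r addr0 mul1r add0n -/p -/q => eqs.
have: 0 <= sin th * act (alpha s) w 0 k.
  rewrite wE actM.
  have -> : sin th * act (act (alpha s) (alt (gen t) (gen s) k0)) v 0 k =
     act (act (sin th *: alpha s) (alt (gen t) (gen s) k0)) v 0 k.
    by rewrite !actZ [in RHS]mxE.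
  rewrite eqs actD !actZ mxE [X in 0 <= X + _]mxE [X in 0 <= _ + X]mxE.
  by rewrite addr_ge0 // mulr_ge0 // sge // ltnW.
by rewrite pmulr_rge0.
Qed.

(** If [w] is longer than [gen i * w], positivity holds for the latter, whose root is the negative
    one. *)
Lemma root_sign i w :
  (forall k, 0 <= act (alpha i) w 0 k) \/ (forall k, act (alpha i) w 0 k <= 0).
Proof.
case: (leqP (len w) (len (gen i * w))) => [|/ltnW] le; first by left;
  apply: root_pos_of_len.
right=> k; have := @root_pos_of_len i (gen i * w)%g; rewrite genK => /(_ le k).
by rewrite actM act_alpha_gen actN mxE oppr_ge0.
Qed.

(** A generator [gen t] shortening [w] makes [alpha t] moved by [w] a negative root; pairing it with
    a chamber point gives [phi t x <= 0]. Hence [gen t] fixes [x] and can be stripped from [w]. *)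
Lemma chamber_unique x w :
    (forall i, 0 <= phi i x) -> (forall i, 0 <= phi i (act x w)) ->
  act x w = x /\ w \in <<[set gen i | i in [set i | phi i x == 0]]>>%g.
Proof.
have [n] := ubnP (len w); elim: n w => // n IH w /ltnSE lewn x0 xw0.
case: (posnP (len w)) => [/len0 -> | w_gt0]; first by rewrite act1 group1.
have [t lt] : exists t, (len (gen t * w) < len w)%N.
  by case lw: (len w) w_gt0 => [//|l] _; have [t] := len_descent lw; exists t.
have ph0 : phi t x = 0.
  apply/eqP; rewrite eq_le x0 andbT -bil_alpha -(bil_act _ _ w) /bil.
  apply: sumr_le0 => k _; apply: mulr_le0_ge0 => //.
  have := @root_pos_of_len t (gen t * w)%g; rewrite genK => /(_ (ltnW lt) k).
  by rewrite actM act_alpha_gen actN mxE oppr_ge0.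
have xt : act x (gen t) = x by rewrite act_gen ph0 mulr0 scale0r subr0.
have xE : act x w = act x (gen t * w)%g by rewrite actM xt.
have [||e1 e2] := IH (gen t * w)%g _ x0; first exact: leq_trans lt lewn.
  by move=> i; rewrite -xE.
rewrite xE; split=> //; rewrite -(genK t w) groupM //.
by apply: mem_gen; apply: imset_f; rewrite inE ph0.
Qed.

(** * Faces and flats *)

Implicit Types (J : {set 'I_#|S|}) (a b d : gT * {set 'I_#|S|}).
Implicit Types (r : gT * 'I_#|S|) (T X Z : {vspace V}).

(* A pair (w, J) encodes the relatively open face of the arrangement spanned by
   the omega_j w, j in J; pt is an interior point of it and sp its linear span. *)
Definition rho J : V := \sum_(j in J) omega j.
Definition pt a : V := act (rho a.2) a.1.
(* (w, i) encodes the root alpha_i w^-1; rt pairs it with x. *)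
Definition rt r x : R := phi r.2 (act x r.1).
Definition pos x := [set r | 0 < rt r x].

Lemma phi_rho i J : phi i (rho J) = (i \in J)%:R.
Proof.
rewrite phi_sum; case: (boolP (i \in J)) => iJ.
  rewrite (bigD1 i) //= phi_omega eqxx big1 ?addr0 // => j /andP[_ ji].
  by rewrite phi_omega eq_sym (negPf ji).
rewrite big1 // => j jJ; rewrite phi_omega; case: eqP => // ij.
by rewrite ij jJ in iJ.
Qed.

Lemma rtD r x y : rt r (x + y) = rt r x + rt r y.
Proof. by rewrite /rt actD phiD. Qed.
Lemma rtZ r c x : rt r (c *: x) = c * rt r x.
Proof. by rewrite /rt actZ phiZ. Qed.
Lemma rtN r x : rt r (- x) = - rt r x.
Proof. by rewrite -scaleN1r rtZ mulN1r. Qed.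
Lemma rt0 r : rt r 0 = 0.
Proof. by rewrite /rt act0 phi0. Qed.
Lemma rt_sum r I (s : seq I) (P : pred I) (F : I -> V) :
  rt r (\sum_(k <- s | P k) F k) = \sum_(k <- s | P k) rt r (F k).
Proof. by rewrite /rt act_sum phi_sum. Qed.
Lemma rt_act r x w : rt r (act x w) = rt ((w * r.1)%g, r.2) x.
Proof. by rewrite /rt actM. Qed.
Lemma rt_opp r x : rt ((r.1 * gen r.2)%g, r.2) x = - rt r x.
Proof. by rewrite /rt actM phi_gen. Qed.

(** The negative of a root is again a root, so [pos x] records all signs and identifies the open
    face containing [x]. *)
Lemma posP x y : pos x = pos y -> forall r, Num.sg (rt r x) = Num.sg (rt r y).
Proof.
move=> /setP pxy r; have := pxy r; have := pxy ((r.1 * gen r.2)%g, r.2).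
rewrite !inE !rt_opp !oppr_gt0.
by case: sgrP; case: sgrP.
Qed.

Lemma eq_pos x y : (forall r, 0 < rt r x = (0 < rt r y)) -> pos x = pos y.
Proof. by move=> h; apply/setP => r; rewrite !inE. Qed.

Lemma pos_act x y w : pos x = pos y -> pos (act x w) = pos (act y w).
Proof. by move=> /setP h; apply: eq_pos => r; rewrite !rt_act;
  have := h ((w * r.1)%g, r.2); rewrite !inE. Qed.

Lemma pos_rt0 x y r : pos x = pos y -> rt r x = 0 -> rt r y = 0.
Proof. by move=> /posP/(_ r) h x0; apply/eqP; rewrite -sgr_eq0 -h x0 sgr0. Qed.

(* All coefficients of a root have the same sign, so on the closed chamber the
   sign of the root only depends on which simple coordinates are positive. *)
Lemma pos_rho x : (forall i, 0 <= phi i x) -> pos x = pos (rho [set i | 0 < phi i x]).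
Proof.
move=> x0; apply: eq_pos => r; rewrite /rt !phi_act.
have r0 j : 0 <= phi j (rho [set i | 0 < phi i x]) by rewrite phi_rho ler0n.
have [h|h] := root_sign r.2 r.1^-1; last first.
  by apply/idP/idP; rewrite ltNge sumr_le0 // => j _; apply: mulr_le0_ge0.
rewrite !lt0r !sumr_ge0 ?andbT; try by move=> j _; apply: mulr_ge0.
rewrite !psumr_eq0; try by move=> j _; apply: mulr_ge0.
congr (~~ _); apply: eq_all => j /=; rewrite !mulf_eq0 phi_rho inE lt0r x0 andbT.
by case: (phi j x == 0); rewrite ?eqxx ?oner_eq0.
Qed.

Lemma pt_exists x : exists a, pos (pt a) = pos x.
Proof.
have [w wP] := to_chamber x.
exists (w^-1%g, [set i | 0 < phi i (act x w)]); rewrite /pt /=.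
by rewrite -{2}(actK w x); apply: pos_act; rewrite -pos_rho.
Qed.

(** The inverse of [b.1] takes [pt b] to [rho b.2] and, by equality of signs, [pt a] into the closed
    chamber, which meets each orbit only once. *)
Lemma pos_pt_inj a b : pos (pt a) = pos (pt b) -> pt a = pt b /\ a.2 = b.2.
Proof.
move=> pab; pose x := act (rho a.2) (a.1 * b.1^-1)%g.
have px : pos x = pos (rho b.2).
  by rewrite /x actM -[rho b.2](actK b.1); apply: pos_act.
have x0 i : 0 <= phi i x.
  have := posP px (1%g, i); rewrite /rt !act1 /= phi_rho => h.
  by rewrite -sgr_ge0 h sgr_ge0 ler0n.
have [|xE _] := @chamber_unique (rho a.2) (a.1 * b.1^-1)%g _ x0.
  by move=> i; rewrite phi_rho ler0n.
have ab2 : a.2 = b.2.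
  apply/setP => i; have := posP px (1%g, i); rewrite /rt !act1 /= /x xE !phi_rho.
  by case: (i \in a.2); case: (i \in b.2) => //= /eqP;
    rewrite ?sgr0 ?sgr1 ?oner_eq0 // eq_sym oner_eq0.
split=> //; move: xE; rewrite actM => /(congr1 (act^~ b.1)).
by rewrite actKV /pt ab2.
Qed.

(* Several pairs encode the same face; this is a canonical one for the face of x. *)
Definition face_of x : gT * {set 'I_#|S|} :=
  odflt (1%g, set0) [pick a | pos (pt a) == pos x].

Lemma face_ofP x : pos (pt (face_of x)) = pos x.
Proof.
rewrite /face_of; case: pickP => [a /eqP //|/= h].
by have [a ax] := pt_exists x; have := h a; rewrite ax eqxx.
Qed.

Lemma face_of_eq x y : pos x = pos y -> face_of x = face_of y.
Proof. by move=> h; rewrite /face_of h. Qed.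

(** Fixed points of the canonical choice, so each face is listed exactly once. *)
Definition faces : {set gT * {set 'I_#|S|}} := [set a | face_of (pt a) == a].

Lemma face_of_faces x : face_of x \in faces.
Proof. by rewrite inE; apply/eqP/face_of_eq/face_ofP. Qed.

Lemma face_of_pt a : pt (face_of (pt a)) = pt a /\ (face_of (pt a)).2 = a.2.
Proof. exact: pos_pt_inj (face_ofP _). Qed.

Definition XJ J : {vspace V} := (\sum_(j in J) <[omega j]>)%VS.

Lemma mem_XJ J x : reflect (forall i, i \notin J -> phi i x = 0) (x \in XJ J).
Proof.
apply: (iffP idP) => [/memv_sumP[u uJ ->] i iJ | x0].
  rewrite phi_sum big1 // => j jJ; have /vlineP[c ->] := uJ j jJ.
  rewrite phiZ phi_omega; case: eqP => [ij|_]; last by rewrite mulr0.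
  by rewrite ij jJ in iJ.
rewrite [x]omega_basis (bigID (mem J)) /= [X in _ + X]big1 ?addr0 => [|j jJ].
  by apply: memv_sumr => j jJ; rewrite memvZ // memv_line.
by rewrite x0 // scale0r.
Qed.

(** The upper bounds for [J] and for its complement are attained because the two spans together fill
    the space. *)
Lemma dim_XJ J : \dim (XJ J) = #|J|.
Proof.
have le J' : (\dim (XJ J') <= #|J'|)%N.
  rewrite /XJ; apply: leq_trans (dimv_leq_sum _ _ _) _.
  by rewrite -[#|J'|]sum1_card; apply: leq_sum => j _; rewrite dim_vline;
    case: (_ == _).
apply/eqP; rewrite eqn_leq le /= -(leq_add2r #|~: J|) cardsC card_ord.
apply: leq_trans (leq_add (leqnn _) (le _)).
apply: leq_trans (dimv_add_leqif _ _).
rewrite (_ : (XJ J + XJ (~: J) = fullv)%VS) ?dimvf ?dim_matrix -?[(1 * _)%R]/(1 *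
  _)%N ?mul1n //.
apply/vspaceP => x; rewrite memvf.
rewrite [x]omega_basis (bigID (mem J)) /= memv_add //.
  by apply: memv_sumr => j jJ; rewrite memvZ // memv_line.
rewrite (eq_bigl (mem (~: J))) => [|j]; last by rewrite /= in_setC.
by apply: memv_sumr => j jJ; rewrite memvZ // memv_line.
Qed.

Lemma translateP w X x : (x \in translate rG w X) = (act x w^-1%g \in X).
Proof.
apply/memv_imgP/idP => [[y yX ->]|xX].
  by rewrite lfunE /= -/(act y w) actK.
by exists (act x w^-1%g) => //; rewrite lfunE /= -/(act _ w) actKV.
Qed.

Lemma dim_translate w X : \dim (translate rG w X) = \dim X.
Proof.
apply: limg_dim_eq; apply/eqP; rewrite -subv0; apply/subvP => x.
rewrite memv_cap memv_ker lfunE /= -/(act x w) => /andP[_ /eqP h].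
by rewrite -(actK w x) h act0 mem0v.
Qed.

Definition sp a : {vspace V} := translate rG a.1 (XJ a.2).

Lemma dim_sp a : \dim (sp a) = #|a.2|.
Proof. by rewrite dim_translate dim_XJ. Qed.

Lemma mem_sp a x :
  reflect (forall i, i \notin a.2 -> rt ((a.1)^-1%g, i) x = 0) (x \in sp a).
Proof. by rewrite translateP; apply: (iffP (mem_XJ _ _)). Qed.

(** A root evaluated at [pt a] is a sum of terms of one sign, so if it vanishes there each term
    vanishes, and with it the root on all of [sp a]. *)
Lemma sp_rt a x : (forall r, rt r (pt a) = 0 -> rt r x = 0) <-> x \in sp a.
Proof.
split=> [h|].
  by apply/mem_sp => i ia; apply: h; rewrite /rt /pt /= actK phi_rho (negPf ia).
rewrite translateP => /mem_XJ h r.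
have -> : rt r x = rt ((a.1 * r.1)%g, r.2) (act x a.1^-1) by rewrite -rt_act actKV.
rewrite /pt rt_act.
rewrite /rt !phi_act /=; set c := act _ _.
have [h0|h0] := root_sign r.2 (a.1 * r.1)^-1; rewrite -/c in h0.
  move/eqP; rewrite psumr_eq0 => [/allP c0|j _];
    last by rewrite mulr_ge0 // phi_rho ler0n.
  rewrite big1 // => j _; case: (boolP (j \in a.2)) => ja; last by rewrite h // mulr0.
  by have := c0 j (mem_index_enum _); rewrite phi_rho ja mulr1 => /eqP->; rewrite mul0r.
move/eqP; rewrite -oppr_eq0 -sumrN psumr_eq0 => [/allP c0|j _]; last first.
  by rewrite oppr_ge0 mulr_le0_ge0 // phi_rho ler0n.
rewrite big1 // => j _; case: (boolP (j \in a.2)) => ja; last by rewrite h // mulr0.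
have := c0 j (mem_index_enum _); rewrite phi_rho ja mulr1 /= oppr_eq0.
by move=> /eqP->; rewrite mul0r.
Qed.

Lemma pt_sp a : pt a \in sp a.
Proof. by apply/sp_rt. Qed.

Lemma omega_sp a j : j \in a.2 -> act (omega j) a.1 \in sp a.
Proof.
move=> ja; rewrite translateP actK; apply/mem_XJ => i ia.
by rewrite phi_omega; case: eqP => // ij; rewrite ij ja in ia.
Qed.

Lemma sp_pt a b : pt a = pt b -> sp a = sp b.
Proof. by move=> ab; apply/vspaceP => x; apply/idP/idP => /sp_rt h; apply/sp_rt;
  rewrite ?ab // -ab. Qed.

(* Closed under taking spans of faces: this characterizes the flats, see
   mem_lattice. *)
Definition isflat T := forall x y, x \in T ->
  (forall r, rt r x = 0 -> rt r y = 0) -> y \in T.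

Lemma isflat_sp a : isflat (sp a).
Proof. by move=> x y /sp_rt h xy; apply/sp_rt => r /h/xy. Qed.

Lemma flat_sp T a : isflat T -> pt a \in T -> (sp a <= T)%VS.
Proof. by move=> fT aT; apply/subvP => x /sp_rt h; apply: fT aT h. Qed.

Lemma isflat_cap T X : isflat T -> isflat X -> isflat (T :&: X)%VS.
Proof.
move=> fT fX x y; rewrite !memv_cap => /andP[xT xX] h.
by rewrite (fT _ _ xT h) (fX _ _ xX h).
Qed.

Lemma isflat_full : isflat fullv.
Proof. by move=> x y _ _; apply: memvf. Qed.

Lemma isflat0 : isflat 0%VS.
Proof.
move=> x y; rewrite !memv0 => /eqP-> h; apply/eqP/phi_inj => i.
by have := h (1%g, i); rewrite rt0 /rt act1; apply.
Qed.

Lemma isflat_translate w T : isflat T -> isflat (translate rG w T).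
Proof.
move=> fT x y; rewrite !translateP => xT h; apply: fT xT _ => r.
by rewrite !rt_act; apply: h.
Qed.

(** This is [small_perturbation] over all roots and points; a negative value becomes positive on the
    opposite root. *)
Lemma small_step (zs : seq V) y : exists2 e : R, 0 < e &
  {in zs, forall z r, Num.sg (rt r (z + e *: y)) =
    if rt r z == 0 then Num.sg (rt r y) else Num.sg (rt r z)}.
Proof.
pose s := [seq (rt r z, rt r y) | z <- zs, r <- enum [set: gT * 'I_#|S|]].
have [e e0 he] := small_perturbation s; exists e => // z zzs.
have hp r : 0 < rt r z -> 0 < rt r (z + e *: y).
  rewrite rtD rtZ; apply: (he (rt r z, rt r y)).
  by apply/allpairsP; exists (z, r); split=> //=; rewrite mem_enum inE.
move=> r; case: eqP => [z0|/eqP].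
  by rewrite rtD z0 add0r rtZ sgrM (gtr0_sg e0) mul1r.
rewrite neq_lt => /orP[zn|/[dup] zp /hp hz]; last by rewrite !gtr0_sg.
have := hp ((r.1 * gen r.2)%g, r.2); rewrite !rt_opp !oppr_gt0 => /(_ zn) hz.
by rewrite !ltr0_sg.
Qed.

(** Take [z] with the most positive roots. A root vanishing at [z] but not on [T] could be made
    positive by a short step inside [T] that keeps the other roots positive. *)
Lemma generic T : exists2 z, z \in T &
  forall r, rt r z = 0 -> {in T, forall x, rt r x = 0}.
Proof.
have exP : exists k, `[< exists2 z, z \in T & #|pos z| = k >].
  by exists #|pos 0|; apply/asboolP; exists 0; rewrite ?mem0v.
have leP k : `[< exists2 z, z \in T & #|pos z| = k >] -> (k <= #|{: gT * 'I_#|S| }|)%N.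
  by move=> /asboolP[z _ <-]; apply: max_card.
case: (ex_maxnP exP leP) => k /asboolP[z zT <-] kmax; exists z => // r rz0 x xT.
apply: contrapT => /eqP rx0.
pose y := Num.sg (rt r x) *: x.
have yT : y \in T by rewrite memvZ.
have ry : 0 < rt r y by rewrite rtZ -normrEsg normr_gt0.
have [e e0 he] := small_step [:: z] y.
have zyT : z + e *: y \in T by rewrite memvD // memvZ.
have /asboolP/kmax : exists2 z', z' \in T & #|pos z'| = #|pos (z + e *: y)|.
  by exists (z + e *: y).
apply/negP; rewrite -ltnNge; apply: proper_card; apply/properP; split.
  apply/subsetP => q; rewrite !inE => zq.
  by rewrite -sgr_gt0 he ?inE // (gt_eqF zq) sgr_gt0.
by exists r; rewrite inE ?rz0 ?ltxx // -sgr_gt0 he ?inE // rz0 eqxx sgr_gt0.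
Qed.

(** * Stabilizers, walls and chamber coordinates *)

Definition stabv x : {set gT} := [set w | act x w == x].

Lemma stabv_group_set x : group_set (stabv x).
Proof.
apply/group_setP; split=> [|w u]; rewrite !inE ?act1 // => /eqP xw /eqP xu.
by rewrite actM xw xu.
Qed.
Canonical stabv_group x := Group (stabv_group_set x).

(** Indexed by the complement of the generators, so that [parabolic J] is the stabilizer of the face
    spanned by the [omega j] with [j] in [J]. *)
Definition parabolic J : {set gT} := <<[set gen i | i in ~: J]>>%g.

Lemma parabolic_fix J w x : w \in parabolic J -> x \in XJ J -> act x w = x.
Proof.
move=> wJ /mem_XJ xJ; apply/eqP; move: wJ;
  have -> : (act x w == x) = (w \in stabv x) by rewrite inE.
apply/subsetP; rewrite gen_subG; apply/subsetP => s /imsetP[i]; rewrite inE => iJ ->.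
by rewrite inE act_gen xJ // mulr0 scale0r subr0.
Qed.

Lemma stab_rho J w : act (rho J) w = rho J -> w \in parabolic J.
Proof.
move=> h; have := @chamber_unique (rho J) w; rewrite h.
have -> : [set i | phi i (rho J) == 0] = ~: J.
  by apply/setP => i; rewrite !inE phi_rho pnatr_eq0; case: (_ \in _).
by case=> [i|i|_ //]; rewrite phi_rho ler0n.
Qed.

Definition wall r : {vspace V} := fixedSpace (repr_end rG (gen r.2 ^ r.1^-1)%g).

Lemma mem_wall r x : (x \in wall r) = (rt r x == 0).
Proof.
have -> : (x \in wall r) = (act x (gen r.2 ^ r.1^-1)%g == x).
  by apply/fixedSpaceP/eqP; rewrite lfunE.
rewrite conjgE invgK !actM (can2_eq (actKV r.1) (actK r.1)) act_gen /rt.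
rewrite -subr_eq0 addrAC subrr add0r oppr_eq0 scaler_eq0 mulf_eq0 pnatr_eq0 /=.
case: (phi _ _ == 0) => //=; apply/negP => /eqP/matrixP/(_ 0 r.2)/eqP.
by rewrite !mxE !eqxx oner_eq0.
Qed.

(** The reflection minus the identity has the wall as kernel and its image in the line of the root;
    rank-nullity on [T] concludes. *)
Lemma cap_dim_wall T r : ~~ (T <= wall r)%VS -> \dim T = (\dim (T :&: wall r)).+1.
Proof.
move=> nT; pose f := (repr_end rG (gen r.2 ^ r.1^-1)%g - \1)%VF.
have := limg_ker_dim f T; rewrite -[lker f]/(wall r) => <-.
suff -> : \dim (f @: T) = 1%N by rewrite addn1.
apply/eqP; rewrite eqn_leq; apply/andP; split.
  apply: (@leq_trans (\dim <[act (alpha r.2) r.1^-1]>)).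
    apply: dimvS; apply/subvP => y /memv_imgP[x _ ->].
    rewrite add_lfunE opp_lfunE id_lfunE lfunE /= -/(act x _) conjgE invgK !actM
      act_gen actD actN actZ actK.
    by rewrite addrAC subrr add0r memvN memvZ // memv_line.
  by rewrite dim_vline leq_b1.
rewrite lt0n dimv_eq0; apply: contra nT => /eqP f0; apply/subvP => x xT.
suff: x \in lker f by [].
by rewrite memv_ker -memv0 -f0 memv_img.
Qed.

Lemma rt_omega r w j : rt r (act (omega j) w) = act (alpha r.2) (w * r.1)^-1 0 j.
Proof.
rewrite rt_act /rt /= phi_act (bigD1 j) //= phi_omega eqxx mulr1 big1 ?addr0 // => k kj.
by rewrite phi_omega (negPf kj) mulr0.
Qed.

Lemma rt_coord w J j : rt (w^-1%g, j) (act (rho J) w) = (j \in J)%:R.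
Proof. by rewrite /rt actK phi_rho. Qed.

(** Only the simple functionals of the chamber of [d.1] need testing: by [pos_rho] they determine
    all other signs. *)
Lemma pos_ptP d x :
  pos x = pos (pt d) <->
  forall j, if j \in d.2 then 0 < rt (d.1^-1%g, j) x else rt (d.1^-1%g, j) x == 0.
Proof.
split=> [/posP h j|h].
  have := h (d.1^-1%g, j); rewrite rt_coord.
  case: (j \in d.2); rewrite ?sgr0 => /eqP; last by rewrite sgr_eq0.
  by rewrite sgr1 sgr_cp0.
pose y := act x d.1^-1.
have y0 i : 0 <= phi i y by have := h i; rewrite /rt -/y;
  case: ifP => _ => [/ltW|/eqP->].
rewrite -(actKV d.1 x) -/y; apply: pos_act; rewrite (pos_rho y0).
congr (pos (rho _)); apply/setP => i; rewrite inE.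
by have := h i; rewrite /rt -/y /=; case: (i \in d.2) => [->//|/eqP->]; rewrite ltxx.
Qed.

Lemma pos_closed_face d x : (forall j, 0 <= rt (d.1^-1%g, j) x) ->
  pos x = pos (act (rho [set j | 0 < rt (d.1^-1%g, j) x]) d.1).
Proof.
move=> x0; rewrite -{1}(actKV d.1 x); apply: pos_act.
exact: (pos_rho (x := act x d.1^-1)).
Qed.

(** * Faces meeting a hyperplane only in zero *)

Section Hyperplane.

Variables (X Z : {vspace V}).
Hypotheses (fZ : isflat Z) (ZX : (Z <= X)%VS).
Hypothesis dimX : \dim X = (\dim Z).+1.

(** Some root vanishes at a generic point of [Z] but not at a chosen [y] outside [Z], since
    otherwise flatness would put [y] in [Z]. It cuts out of [X] a proper subspace containing [Z],
    which is [Z] by dimension. *)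
Lemma hyperplane_root : exists r0, {in X, forall x, (x \in Z) = (rt r0 x == 0)}.
Proof.
have [z zZ gz] := generic Z.
have [y yX yZ] : exists2 y, y \in X & y \notin Z.
  by apply/subvPn; apply/negP => /dimvS; rewrite dimX ltnn.
have [r0 rz ry] : exists2 r0, rt r0 z = 0 & rt r0 y != 0.
  apply: contrapT => h; move/negP: yZ; apply; apply: fZ zZ _ => r rz.
  by apply: contrapT => /eqP ry; apply: h; exists r.
exists r0 => x xX.
have ZW : (Z <= X :&: wall r0)%VS.
  by rewrite subv_cap ZX; apply/subvP => x' x'Z; rewrite mem_wall (gz _ rz).
suff ZE : Z = (X :&: wall r0)%VS by rewrite {1}ZE memv_cap xX mem_wall.
apply/eqP; rewrite eqEdim ZW -ltnS -dimX.
rewrite (ltn_leqif (dimv_leqif_sup (capvSl _ _))); apply/subvPn; exists y => //.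
by rewrite memv_cap yX mem_wall.
Qed.

(* The closed face a meets Z only in 0. *)
Definition bounded a := [forall j in a.2, act (omega j) a.1 \notin Z].

(** Two encodings differ by an element fixing [rho b.2]; it lies in [parabolic b.2] and so fixes
    each ray separately. *)
Lemma bounded_pt a b : pt a = pt b -> bounded a = bounded b.
Proof.
move=> ab; have [_ ab2] := pos_pt_inj (congr1 pos ab).
suff om_ab j : j \in b.2 -> act (omega j) a.1 = act (omega j) b.1.
  by rewrite /bounded ab2; apply: eq_forallb_in => j jb; rewrite om_ab.
move=> jb; suff h : act (omega j) (a.1 * b.1^-1)%g = omega j by rewrite -{2}h actM
  actKV.
apply: (@parabolic_fix b.2).
  apply: stab_rho; rewrite actM -{1}ab2 -[act (rho a.2) a.1]/(pt a) ab.
  exact: actK.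
by apply/mem_XJ => i ib; rewrite phi_omega; case: eqP => // ij; rewrite ij jb in ib.
Qed.

Section ProperFlat.

Variables (T : {vspace V}) (z0 y : V) (r0 : gT * 'I_#|S|).
Hypotheses (fT : isflat T) (TX : (T <= X)%VS).
Hypothesis Zr0 : {in X, forall x, (x \in Z) = (rt r0 x == 0)}.
Hypotheses (z0T : z0 \in T) (z0Z : z0 \in Z) (yT : y \in T) (yZ : y \notin Z).
Hypothesis gen_z0 : forall r, rt r z0 = 0 -> {in (T :&: Z)%VS, forall x, rt r x = 0}.

(* x is an infinitesimal perturbation of z0 in the direction c y. *)
Definition lex_sign c x := forall r, Num.sg (rt r x) =
  if rt r z0 == 0 then c * Num.sg (rt r y) else Num.sg (rt r z0).

Let r0y : rt r0 y != 0.
Proof. by rewrite -(Zr0 (subvP TX _ yT)). Qed.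

(** Such a root vanishes at [z0] and at [y]. Subtracting a multiple of [y] moves [x'] into
    [T :&: Z], where [z0] is generic. *)
Lemma lex_generic c x : c != 0 -> lex_sign c x ->
  forall r, rt r x = 0 -> {in T, forall x', rt r x' = 0}.
Proof.
move=> c0 hx r rx0 x' x'T; have := hx r; rewrite rx0 sgr0.
case: eqP => [rz|/eqP rz /esym/eqP]; last by rewrite sgr_eq0 (negPf rz).
move/esym/eqP; rewrite mulf_eq0 (negPf c0) sgr_eq0 /= => /eqP ry0.
pose k := rt r0 x' / rt r0 y.
have: rt r (x' - k *: y) = 0.
  apply: gen_z0 => //; have uT : x' - k *: y \in T by rewrite memvB // memvZ.
  rewrite memv_cap uT Zr0 ?(subvP TX) // rtD rtN rtZ /k divfK //.
  by rewrite subrr eqxx.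
by rewrite rtD rtN rtZ ry0 mulr0 subr0.
Qed.

Lemma sp_lex c x d : c != 0 -> lex_sign c x -> x \in T -> pos x = pos (pt d) ->
  sp d = T.
Proof.
move=> c0 hx xT px; apply/vspaceP => x'; apply/idP/idP => [/sp_rt h|x'T].
  by apply: fT xT _ => r rx; apply: h; apply: pos_rt0 rx.
apply/sp_rt => r rd; apply: (lex_generic c0 hx) => //.
by apply: pos_rt0 rd.
Qed.

(** The rays of [d] outside [Z]; its subsets are the bounded faces of [d]. *)
Definition off_wall d : {set 'I_#|S|} := [set j in d.2 | act (omega j) d.1 \notin Z].

Lemma bounded_subset w J d : J \subset d.2 -> w = d.1 ->
  bounded (w, J) = (J \subset off_wall d).
Proof.
move=> Jd ->; apply/forall_inP/subsetP => h j jJ;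
  first by rewrite inE (subsetP Jd) //= h.
by have := h j jJ; rewrite inE => /andP[].
Qed.

(* On a chamber of T the functional r0 has constant sign, so at z0, where it
   vanishes, no cancellation is possible. *)
Lemma facet_lex d xi xi' : sp d = T -> lex_sign 1 xi -> lex_sign (-1) xi' ->
  (pos xi' = pos (pt d)) <->
  ([set j in d.2 | rt (d.1^-1%g, j) xi < 0] = off_wall d).
Proof.
move=> spd hxi hxi'.
pose c j x := rt (d.1^-1%g, j) x.
have omT j : j \in d.2 -> act (omega j) d.1 \in T by rewrite -spd; apply: omega_sp.
have c_om j k : c j (act (omega k) d.1) = (j == k)%:R by rewrite /c /rt actK phi_omega.
have cT x j : x \in T -> j \notin d.2 -> c j x = 0.
  by rewrite -spd => /mem_sp; apply.
have r0E x : x \in T -> rt r0 x = \sum_(j in d.2) c j x * rt r0 (act (omega j) d.1).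
  move=> xT; rewrite {1}[x](_ : _ = \sum_j c j x *: act (omega j) d.1).
    rewrite rt_sum (bigID (mem d.2)) /= [X in _ + X]big1 ?addr0.
      by apply: eq_bigr => j _; rewrite rtZ.
    by move=> j jd; rewrite cT // scale0r rt0.
  rewrite -{1}(actKV d.1 x) {1}[act x _]omega_basis act_sum.
  by apply: eq_bigr => j _; rewrite actZ.
have offE j : j \in d.2 -> (j \in off_wall d) = (rt r0 (act (omega j) d.1) != 0).
  by move=> jd; rewrite inE jd -Zr0 // (subvP TX) // omT.
(* A coordinate vanishing at the generic point [z0] vanishes on all of [T :&: Z], but this ray lies
   there and has coordinate 1. *)
have on_wall j : j \in d.2 -> j \notin off_wall d -> c j z0 != 0.
  move=> jd; rewrite inE jd negbK => omZ; apply/eqP => cz.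
  have /gen_z0/(_ (act (omega j) d.1)) := cz;
    rewrite memv_cap omT // omZ => /(_ isT)/eqP.
  by rewrite -[rt _ _]/(c j _) c_om eqxx oner_eq0.
have r0_sign : exists2 s : R, s != 0 & forall j, j \in off_wall d ->
    0 < s * rt r0 (act (omega j) d.1).
  have [h|h] := root_sign r0.2 (d.1 * r0.1)^-1.
    exists 1; rewrite ?oner_eq0 // => j /[dup] jo; rewrite inE => /andP[jd _].
    by move: jo; rewrite offE // mul1r rt_omega lt0r h andbT.
  exists (-1); rewrite ?oppr_eq0 ?oner_eq0 // => j /[dup] jo;
    rewrite inE => /andP[jd _].
  by move: jo; rewrite offE // mulN1r oppr_gt0 rt_omega lt_neqAle h andbT.
have [s s0 spos] := r0_sign.
(* Expanding [rt r0 z0 = 0] over the rays leaves only those off [Z], weighted by values of one sign;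
   if the coordinates also share a sign, they all vanish. Below, [e] is 1 or -1. *)
have sum_off e : (forall j, j \in off_wall d -> 0 <= e * c j z0) ->
    forall j, j \in off_wall d -> e * c j z0 = 0.
  move=> h j jo.
  have: \sum_(j in off_wall d) e * c j z0 * (s * rt r0 (act (omega j) d.1)) = 0.
    have h0 : \sum_(j in off_wall d) c j z0 * rt r0 (act (omega j) d.1) = 0.
      have : rt r0 z0 = 0 by apply/eqP; rewrite -Zr0 // (subvP ZX).
      rewrite r0E // (bigID (mem (off_wall d))) /= [X in _ + X]big1 ?addr0 => [h0|k
        /andP[kd ko]].
        by rewrite -[RHS]h0; apply: eq_bigl => k; rewrite inE andbA andbb.
      by move: ko; rewrite offE // negbK => /eqP->; rewrite mulr0.
    rewrite -[RHS](mulr0 (e * s)) -[in RHS]h0 mulr_sumr.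
    by apply: eq_bigr => k _; ring.
  move/eqP; rewrite psumr_eq0 => [|k ko]; last by rewrite mulr_ge0 ?h // ltW // spos.
  move/allP/(_ j (mem_index_enum _)); rewrite jo mulf_eq0 (gt_eqF (spos j jo)) orbF.
  by move/eqP.
(* If [xi'] lies in [d], the coordinates of [z0] are nonnegative, hence zero on the rays off [Z],
   where [xi] and [xi'] then have opposite signs. *)
split=> [/pos_ptP h|h].
  have cz j : j \in d.2 -> 0 <= c j z0.
    move=> jd; have := h j; rewrite jd -sgr_gt0 hxi' -/(c j z0).
    by case: eqP => [->//|_]; rewrite sgr_gt0 => /ltW.
  apply/setP => j; rewrite [LHS]inE; case: (boolP (j \in d.2)) => jd /=; last first.
    by rewrite inE (negPf jd).
  rewrite -sgr_lt0 hxi mul1r -/(c j z0).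
  case: (boolP (j \in off_wall d)) => jo.
    have /(_ 1)/(_ _ j jo) := sum_off; rewrite mul1r => ->; last first.
      by move=> k; rewrite inE mul1r => /andP[/cz].
    rewrite eqxx; have := h j; rewrite jd -sgr_gt0 hxi' -/(c j z0).
    have /(_ 1)/(_ _ j jo) := sum_off; rewrite mul1r => ->; last first.
      by move=> k; rewrite inE mul1r => /andP[/cz].
    by rewrite eqxx mulN1r oppr_gt0.
  have := on_wall j jd jo; case: eqP => // _ cz0; rewrite sgr_lt0.
  by apply/negbTE; rewrite -leNgt cz.
have offN j : j \in off_wall d -> rt (d.1^-1%g, j) xi < 0.
  by rewrite -h inE => /andP[].
have cz0 j : j \in off_wall d -> c j z0 = 0.
  move=> jo; have := sum_off (-1) _ j jo; rewrite mulN1r => /(_ _)/eqP.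
  rewrite oppr_eq0 => H; apply/eqP/H => k ko; rewrite mulN1r oppr_ge0.
  have := offN k ko; rewrite -sgr_lt0 hxi -/(c k z0); case: eqP => [->//|_].
  by rewrite sgr_lt0 => /ltW.
apply/pos_ptP => j; case: ifPn => jd; last first.
  rewrite -sgr_eq0 hxi' -/(c j z0) -/(c j y) !cT //.
  by rewrite eqxx sgr0 mulr0.
rewrite -sgr_gt0 hxi' -/(c j z0).
case: (boolP (j \in off_wall d)) => jo.
  have := offN j jo; rewrite -sgr_lt0 hxi -/(c j z0) cz0 // eqxx.
  by rewrite mul1r mulN1r oppr_gt0.
have nz := on_wall j jd jo; rewrite (negPf nz) sgr_gt0 lt0r nz /=.
rewrite leNgt; apply: contra jo => cneg; rewrite -h inE jd /=.
by rewrite -sgr_lt0 hxi -/(c j z0) (negPf nz) sgr_lt0.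
Qed.

(** With two rays off [Z], some combination of them lies in [T :&: Z] and has a nonzero coordinate
    that vanishes at [z0], against genericity. With none, [y] would lie in [Z]. *)
Lemma card_off_wall d xi xi' : sp d = T -> lex_sign 1 xi -> lex_sign (-1) xi' ->
  pos xi' = pos (pt d) -> #|off_wall d| = 1%N.
Proof.
move=> spd hxi hxi' pd; have h := (facet_lex spd hxi hxi').1 pd.
have omT j : j \in d.2 -> act (omega j) d.1 \in T by rewrite -spd; apply: omega_sp.
have [j jo] : exists j, j \in off_wall d.
  apply: contrapT => no; move/negP: yZ; apply.
  move: yT; rewrite -spd translateP => /mem_XJ yd.
  rewrite -(actKV d.1 y) [act y _]omega_basis act_sum.
  apply: memv_suml => k _; rewrite actZ; case: (boolP (k \in d.2)) => kd.
    by rewrite memvZ //; apply: contrapT => /negP kZ; apply: no; exists k;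
      rewrite inE kd.
  by rewrite yd // scale0r mem0v.
have [jd jZ] : j \in d.2 /\ act (omega j) d.1 \notin Z by move: jo;
  rewrite inE => /andP.
have cz : rt (d.1^-1%g, j) z0 = 0.
  apply: contrapT => /eqP nz; have := (pos_ptP d xi').1 pd j.
  rewrite jd -sgr_gt0 hxi' (negPf nz); move: jo; rewrite -h inE jd /=.
  by rewrite -sgr_lt0 hxi (negPf nz) => /ltW; rewrite leNgt => /negPf->.
apply/eqP/cards1P; exists j; apply/setP => k; rewrite [RHS]inE.
apply/idP/eqP => [ko|-> //]; apply: contrapT => /eqP kj.
have [kd kZ] : k \in d.2 /\ act (omega k) d.1 \notin Z by move: ko;
  rewrite inE => /andP.
pose v := rt r0 (act (omega k) d.1) *: act (omega j) d.1 - rt r0 (act (omega j) d.1)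
  *: act (omega k) d.1.
have vT : v \in T by rewrite memvB // memvZ // omT.
have vZ : v \in Z.
  by rewrite Zr0 ?(subvP TX) // rtD rtN !rtZ mulrC subrr.
have := gen_z0 cz; move/(_ v); rewrite memv_cap vT vZ => /(_ isT).
rewrite rtD rtN !rtZ {2}/rt {3}/rt /= !actK !phi_omega eqxx eq_sym (negPf kj) mulr1
  mulr0 subr0.
by move/eqP; rewrite -Zr0 ?(negPf kZ) // (subvP TX) ?omT.
Qed.

End ProperFlat.

(** [G] pushes each face towards [xi]. The bounded faces pushed into a chamber [d] of [T] are the
    sets between [J0 d] and [off_wall d], so only the chamber of the opposite perturbation [xi']
    survives, contributing -1. *)
Lemma sum_bounded T : isflat T -> (T <= X)%VS -> ~~ (T <= Z)%VS ->
  \sum_(b in faces | (pt b \in T) && bounded b) (-1) ^+ #|b.2| = -1 :> int.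
Proof.
move=> fT TX nTZ; have [r0 Zr0] := hyperplane_root.
have [z0] := generic (T :&: Z)%VS; rewrite memv_cap => /andP[z0T z0Z] gz0.
have [y yT yZ] := subvPn nTZ.
have [e1 e1_gt0 h1] := small_step [:: z0] y.
have [e2 e2_gt0 h2] := small_step [:: z0] (- y).
pose xi := z0 + e1 *: y; pose xi' := z0 + e2 *: (- y).
have lxi : lex_sign z0 y 1 xi by move=> r; rewrite h1 ?inE // mul1r.
have lxi' : lex_sign z0 y (-1) xi'.
  by move=> r; rewrite h2 ?inE // rtN sgrN mulN1r.
have xiT : xi \in T by rewrite memvD // memvZ.
have xi'T : xi' \in T by rewrite memvD // memvZ // memvN.
have gxi := lex_generic TX Zr0 yT yZ gz0 (oner_neq0 _) lxi.
have [e e_gt0 he] := small_step [seq pt b | b <- enum [set: gT * {set 'I_#|S|}]] xi.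
have {}he b : forall r, Num.sg (rt r (pt b + e *: xi)) =
    if rt r (pt b) == 0 then Num.sg (rt r xi) else Num.sg (rt r (pt b)).
  by apply: he; apply: map_f; rewrite mem_enum inE.
pose G b := face_of (pt b + e *: xi).
pose J0 d := [set j in d.2 | rt (d.1^-1%g, j) xi < 0].
rewrite (partition_big G (fun d => (d \in faces) && (sp d == T))) /=; last first.
  move=> b /and3P[_ bT _]; rewrite face_of_faces /=; apply/eqP/vspaceP => x.
  have px := esym (face_ofP (pt b + e *: xi)).
  have ptT : pt b + e *: xi \in T by rewrite memvD // memvZ.
  apply/idP/idP => [/sp_rt h|xT].
    by apply: fT ptT _ => r rx; apply: h; apply: pos_rt0 rx.
  apply/sp_rt => r rd; apply: gxi => //; apply/eqP; rewrite -sgr_eq0.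
  have := he b r; rewrite (pos_rt0 (esym px) rd) sgr0.
  by case: eqP => [_ <-|/eqP nz /esym/eqP]; rewrite ?eqxx // sgr_eq0 (negPf nz).
have inner d : d \in faces -> sp d = T ->
    \sum_(b | [&& b \in faces, pt b \in T & bounded b] && (G b == d)) (-1) ^+ #|b.2|
    = (if J0 d == off_wall d then (-1) ^+ #|J0 d| else 0) :> int.
  move=> dF spd; rewrite -sum_sign_subset_interval.
  have offd : off_wall d \subset d.2 by apply/subsetP => j; rewrite inE => /andP[].
  (* The push keeps nonzero signs, so a face pushed into [d] is a face of [d] and is recovered from
     its positive coordinates. *)
  rewrite (reindex_onto (fun J => face_of (pt (d.1, J)))
             (fun b => [set j | 0 < rt (d.1^-1%g, j) (pt b)])) /=; last first.
    move=> b /andP[/and3P[bF bT _] /eqP Gb]; move: (bF); rewrite inE => /eqP {2}<-.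
    apply/face_of_eq/esym/pos_closed_face => j; rewrite leNgt; apply/negP => neg.
    have : pos (pt b + e *: xi) = pos (pt d) by rewrite -(face_ofP (pt b + _)) -/(G
      b) Gb.
    move/pos_ptP/(_ j); have := he b (d.1^-1%g, j);
      rewrite (lt_eqF neg) (ltr0_sg neg) => sE.
    by case: ifP => _;
      [rewrite -sgr_gt0 sE ltr0N1 | rewrite -sgr_eq0 sE oppr_eq0 oner_eq0].
  apply: eq_big => [J|J _]; last by have [_ ->] := face_of_pt (d.1, J).
  have [ptJ J2] := face_of_pt (d.1, J).
  rewrite face_of_faces ptJ (bounded_pt ptJ) /=.
  have coordJ j : rt (d.1^-1%g, j) (pt (d.1, J)) = (j \in J)%:R by rewrite rt_coord.
  have posJ : [set j | 0 < rt (d.1^-1%g, j) (pt (d.1, J))] = J.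
    by apply/setP => j; rewrite inE coordJ ltr0n; case: (j \in J).
  rewrite posJ eqxx andbT.
  have heJ := he (d.1, J).
  have GJ : G (face_of (pt (d.1, J))) = face_of (pt (d.1, J) + e *: xi) by rewrite /G
    ptJ.
  apply/idP/andP => [/andP[/andP[_ bd] /eqP Gd]|[J0J Joff]].
    have /pos_ptP p : pos (pt (d.1, J) + e *: xi) = pos (pt d) by rewrite -face_ofP
      -GJ Gd.
    have Jd : J \subset d.2.
      apply/subsetP => j jJ; have := p j; case: ifP => // _.
      by rewrite -sgr_eq0 heJ coordJ jJ oner_eq0 sgr1 oner_eq0.
    split; last by rewrite -(bounded_subset Jd (erefl _)).
    apply/subsetP => j; rewrite inE => /andP[jd neg]; apply: contraTT neg => jJ.
    have := p j; rewrite jd -sgr_gt0 heJ coordJ (negPf jJ) eqxx sgr_gt0.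
    by rewrite -leNgt => /ltW.
  have Jd := subset_trans Joff offd.
  rewrite (bounded_subset Jd (erefl _)) Joff andbT.
  have -> : pt (d.1, J) \in T.
    rewrite -spd; apply/mem_sp => i id; rewrite coordJ.
    by case: (boolP (i \in J)) => // /(subsetP Jd); rewrite (negPf id).
  have dE : face_of (pt d) == d by rewrite inE in dF.
  rewrite GJ /= -[X in _ == X](eqP dE); apply/eqP/face_of_eq/pos_ptP => j.
  case: ifPn => jd; last first.
    have jJ : j \notin J by apply: contra jd; apply: (subsetP Jd).
    rewrite -sgr_eq0 heJ coordJ (negPf jJ) eqxx sgr_eq0; apply/eqP.
    by move: xiT; rewrite -spd => /mem_sp; apply.
  rewrite -sgr_gt0 heJ coordJ; case: (boolP (j \in J)) => jJ.
    by rewrite oner_eq0 sgr1 ltr01.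
  rewrite eqxx sgr_gt0 lt0r; apply/andP; split.
    apply/eqP => /gxi/(_ (act (omega j) d.1));
      rewrite -{1}spd omega_sp // => /(_ isT)/eqP.
    by rewrite /rt /= actK phi_omega eqxx oner_eq0.
  by rewrite leNgt; apply: contra jJ => neg; apply: (subsetP J0J); rewrite inE jd.
rewrite (eq_bigr _ (fun d hd => inner d (proj1 (andP hd)) (eqP (proj2 (andP hd))))).
pose d0 := face_of xi'.
have pd0 : pos xi' = pos (pt d0) by rewrite face_ofP.
have spd0 : sp d0 = T.
  by apply: (sp_lex fT TX Zr0 yT yZ gz0 _ lxi') => //; rewrite oppr_eq0 oner_eq0.
have eqJ0 d : sp d = T -> pos xi' = pos (pt d) <-> J0 d = off_wall d.
  by move=> spd; apply: facet_lex lxi lxi'; eassumption.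
rewrite (bigD1 d0) /= ?face_of_faces ?spd0 ?eqxx // (eqJ0 _ spd0).1 // eqxx.
have -> : #|off_wall d0| = 1%N by apply: card_off_wall lxi lxi' pd0; eassumption.
rewrite expr1.
rewrite big1 ?addr0 // => d /andP[/andP[dF /eqP spd] nd].
case: eqP => // /(eqJ0 _ spd) pd; case/eqP: nd.
by move: dF; rewrite inE => /eqP <-; apply/face_of_eq.
Qed.

(** Inside [Z] a face with a ray is never bounded, so only the origin contributes. *)
Lemma sum_bounded_sub T : isflat T -> (T <= Z)%VS ->
  \sum_(b in faces | (pt b \in T) && bounded b) (-1) ^+ #|b.2| = 1 :> int.
Proof.
move=> fT TZ.
have set0E b : pt b \in T -> bounded b -> b.2 = set0.
  move=> bT /forall_inP bd; apply/eqP; rewrite -subset0; apply/subsetP => j jb.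
  by have := bd j jb; rewrite (subvP TZ) // (subvP (flat_sp fT bT)) // omega_sp.
have rho0 : rho set0 = 0 by rewrite /rho big_set0.
have pt0 w : pt (w, set0) = 0 by rewrite /pt rho0 act0.
have pt00 : pt (face_of 0) = 0 /\ (face_of 0).2 = set0.
  by have := face_of_pt (1%g, set0); rewrite pt0.
rewrite (big_pred1 (face_of 0)) => [|b /=]; first by rewrite pt00.2 cards0.
apply/idP/eqP => [/and3P[bF bT bd]| ->].
  move: bF; rewrite inE => /eqP <-; case: b bT bd => w J bT bd.
  by rewrite (_ : J = set0) ?pt0 // -(set0E _ bT bd).
rewrite face_of_faces pt00.1 mem0v /=; apply/forall_inP => j.
by rewrite pt00.2 inE.
Qed.

End Hyperplane.

(** * The lattice of flats and the count of bounded chambers *)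

Lemma arrangementP H : reflect (exists r, H = wall r) (H \in reflection_arrangement rG).
Proof.
apply: (iffP (imfsetP _ _ _ _)) => [[t /= /imset2P[s w sS _ ->] ->]|[r ->]].
  by have [i ->] := gen_surj sS; exists (w^-1%g, i); rewrite /wall invgK.
by exists (gen r.2 ^ r.1^-1)%g => //=; apply: memJ_class_support; rewrite ?genP ?inE.
Qed.

Lemma isflat_wall r : isflat (wall r).
Proof. by move=> x y; rewrite !mem_wall => /eqP xr h; rewrite h. Qed.

Lemma memv_bigcap_seq (s : seq {vspace V}) x :
  (x \in \bigcap_(H <- s) H)%VS = all (fun H : {vspace V} => x \in H) s.
Proof.
elim: s => [|H s IH]; first by rewrite big_nil memvf.
by rewrite big_cons memv_cap IH.
Qed.

Lemma isflat_bigcap E (s : seq {vspace V}) : isflat E ->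
  {in s, forall H, isflat (H :&: E)%VS} -> isflat (E :&: \bigcap_(H <- s) H)%VS.
Proof.
move=> fE fs x y; rewrite !memv_cap !memv_bigcap_seq => /andP[xE /allP xs] xy.
rewrite (fE _ _ xE xy); apply/allP => H Hs.
have: y \in (H :&: E)%VS by apply: fs xy => //; rewrite memv_cap xs.
by rewrite memv_cap => /andP[].
Qed.

Lemma isflat_flats T : T \in flats rG -> isflat T.
Proof.
case/imfsetP => A /=; rewrite fpowersetE => /fsubsetP sA ->.
apply: isflat_bigcap isflat_full _ => H /sA/arrangementP[r ->].
by rewrite capvf; apply: isflat_wall.
Qed.

(** For the converse, a point of all restricted hyperplanes through [T] satisfies every root
    equation holding at a generic point of [T]; walls containing [X] impose nothing. *)
Lemma mem_lattice X T : isflat X ->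
  reflect ((T <= X)%VS /\ isflat T)
    (T \in intersection_lattice X (restriction (reflection_arrangement rG) X)).
Proof.
move=> fX; apply: (iffP idP) => [/imfsetP[A /=]|[TX fT]].
  rewrite fpowersetE => /fsubsetP sA ->; split; first exact: capvSl.
  apply: isflat_bigcap => // H /sA/imfsetP[H' /=];
    rewrite inE => /andP[/arrangementP[r ->] _] ->.
  by do 2!apply: isflat_cap => //; apply: isflat_wall.
set B0 := restriction _ _; apply/imfsetP.
exists [fset H in B0 | (T <= H)%VS]%fset => /=.
  by rewrite fpowersetE; apply/fsubsetP => H; rewrite !inE => /andP[].
have [z zT gz] := generic T.
apply/vspaceP => x; rewrite memv_cap memv_bigcap_seq;
  apply/idP/andP => [xT|[xX /allP xH]].
  by rewrite (subvP TX _ xT); split=> //; apply/allP => H;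
    rewrite !inE => /andP[_ /subvP/(_ x xT)].
apply: fT zT _ => r rz; apply/eqP; rewrite -mem_wall.
have TW : (T <= wall r)%VS by apply/subvP => t tT; rewrite mem_wall (gz _ rz).
have [/subvP XW|nXW] := boolP (X <= wall r)%VS; first exact: XW.
have /xH : (wall r :&: X)%VS \in [fset H in B0 | (T <= H)%VS]%fset.
  rewrite !inE subv_cap TW TX !andbT; apply/imfsetP; exists (wall r) => //=.
  by rewrite !inE nXW andbT; apply/arrangementP; exists r.
by rewrite memv_cap => /andP[].
Qed.

Lemma count_bounded X Z (b : seq nat) : isflat X -> isflat Z -> (Z <= X)%VS ->
    \dim X = (\dim Z).+1 -> orlik_solomon_exponents rG X b ->
  #|[set d in faces | (sp d == X) && bounded Z d]|%:R =
    2 * \prod_(1 <= i < \dim X) ((nth 0%N b i)%:R - 1) :> int.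
Proof.
move=> fX fZ ZX dimX [size_b sorted_b pos_b].
rewrite /char_poly_arr; set L := intersection_lattice _ _ => charE.
have LP T : reflect ((T <= X)%VS /\ isflat T) (T \in L) := mem_lattice T fX.
have [r0 Zr0] := hyperplane_root fZ ZX dimX.
have LX : {in L, forall T, (T <= X)%VS} by move=> T /LP[].
have XL : X \in L by apply/LP; split=> //; apply: subvv.
have ZL : Z \in L by apply/LP.
have nZX : Z != X by apply: contra_eqN dimX => /eqP->; rewrite neq_ltn ltnSn.
have LZ : {in L, forall T, (T :&: Z)%VS \in L}.
  by move=> T /LP[TX fT]; apply/LP; split;
    [apply: subv_trans (capvSl _ _) TX | apply: isflat_cap].
have L0 : 0%VS \in L by apply/LP; split; [apply: sub0v | apply: isflat0].
have X0 : 0%VS != X by rewrite eq_sym -dimv_eq0 dimX.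
have dimTZ T : T \in L -> ~~ (T <= Z)%VS -> \dim T = (\dim (T :&: Z)).+1.
  move=> /LP[TX fT] nTZ.
  have capE : (T :&: Z)%VS = (T :&: wall r0)%VS.
    apply/vspaceP => x; rewrite !memv_cap; case: (boolP (x \in T)) => //= xT.
    by rewrite mem_wall Zr0 // (subvP TX).
  rewrite capE; apply: cap_dim_wall; apply: contra nTZ => TW.
  by apply/capv_idPl; rewrite capE; apply/capv_idPl.
pose mu := mobius L X.
(* The recursion defining [mu], read at the flat 0, which every flat contains. *)
have sum_mu0 : \sum_(T <- L) mu T = 0.
  rewrite -[RHS](sum_mobius_eq0 L0 (sub0v X) X0) [RHS]big_mkcond.
  by apply: eq_big_seq => T TL; rewrite sub0v LX.
have dmu := sum_mobius_dim LX ZL nZX LZ dimTZ.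
(* Exchanging the sums weights a face by the total of [mu] over the flats containing its span, which
   is zero unless the span is [X]. *)
have inversion : \sum_(T <- L) mu T *
     (\sum_(d in faces | (pt d \in T) && bounded Z d) (-1) ^+ #|d.2|)
   = (-1) ^+ \dim X * #|[set d in faces | (sp d == X) && bounded Z d]|%:R.
  under eq_bigr do rewrite mulr_sumr big_mkcond /=.
  rewrite exchange_big /= -[#|[set d in faces | _]|]sum1_card natr_sum mulr_sumr
    [RHS]big_mkcond /=.
  apply: eq_bigr => d _; rewrite [in RHS]inE.
  case: (boolP (d \in faces)) => dF /=; last by rewrite big1.
  case: (boolP (bounded Z d)) => bd; last by rewrite andbF big1 // => T _;
    rewrite andbF.
  rewrite andbT; under eq_bigr do rewrite andbT.
  rewrite -big_mkcond -mulr_suml mulr1 /=.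
  have [dX|ndX] := boolP (pt d \in X); last first.
    case: eqP => [dX|_]; first by rewrite -dX pt_sp in ndX.
    rewrite big1_seq ?mul0r // => T /andP[dT TL]; case/negP: ndX.
    by apply: (subvP (LX T TL)).
  have spL : sp d \in L by apply/LP; split; [apply: flat_sp | apply: isflat_sp].
  have spE T : T \in L -> (pt d \in T) = (sp d <= T)%VS && (T <= X)%VS.
    move=> /LP[TX fT]; rewrite TX andbT; apply/idP/idP => [|/subvP];
      first exact: flat_sp.
    by apply; apply: pt_sp.
  rewrite big_seq_cond (eq_bigl (fun T => (T \in L) && ((sp d <= T)%VS && (T <=
    X)%VS))); last first.
    by move=> T; case: (boolP (T \in L)) => //= /spE.
  rewrite -big_seq_cond; case: eqP => [spX|/eqP nspX].
    rewrite (bigD1_seq_cond (j := X)) ?fset_uniq ?spX ?subvv //= big_pred0 => [|T].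
      by rewrite addr0 /mu mobius_top mul1r -dim_sp spX.
    by rewrite -eqEsubv eq_sym andbN.
  by rewrite sum_mobius_eq0 ?mul0r // flat_sp.
(* The alternating sum is 1 for [T] inside [Z] and 1 - 2 otherwise, and the constant 1 drops out
   because [mu] sums to zero. *)
have h_val : \sum_(T <- L) mu T *
     (\sum_(d in faces | (pt d \in T) && bounded Z d) (-1) ^+ #|d.2|)
   = - (2 * \sum_(T <- L | ~~ (T <= Z)%VS) mu T).
  have -> : - (2 * \sum_(T <- L | ~~ (T <= Z)%VS) mu T)
     = \sum_(T <- L) mu T - 2 * \sum_(T <- L | ~~ (T <= Z)%VS) mu T.
    by rewrite sum_mu0 add0r.
  rewrite mulr_sumr [X in _ - X]big_mkcond /= -sumrB; apply: eq_big_seq => T /LP[TX fT].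
  case: ifPn => [nTZ|]; first by rewrite (sum_bounded fZ ZX dimX) //; ring.
  by rewrite negbK => TZ; rewrite sum_bounded_sub // mulr1 subr0.
have root1 : \prod_(c <- b) (1 - c%:Z) = 0 :> int.
  rewrite -[RHS]sum_mu0.
  have -> : \sum_(T <- L) mu T = (\sum_(T <- L) mobius L X T *: 'X^(\dim T)).[1].
    by rewrite horner_sum; apply: eq_bigr => T _; rewrite hornerZ hornerXn expr1n mulr1.
  by rewrite charE horner_prod; apply: eq_bigr => c _; rewrite hornerXsubC.
have [b' bE] := nat_root_first sorted_b pos_b root1.
have der : \sum_(T <- L) mu T * (\dim T)%:Z = \prod_(c <- b') (1 - c%:Z).
  rewrite -deriv_prod_at1 -bE -charE raddf_sum horner_sum.
  apply: eq_bigr => T _; rewrite /= derivZ hornerZ derivXn hornerMn hornerXn expr1n.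
  by rewrite natz.
(* Dropping the first exponent leaves [(\dim X).-1] sign changes; [nth] counts from 0, so index 1 is
   the second exponent. *)
have prodE : \prod_(c <- b') (1 - c%:Z) =
   (-1) ^+ (\dim X).-1 * \prod_(1 <= i < \dim X) ((nth 0%N b i)%:R - 1) :> int.
  rewrite -size_b bE /= big_add1 /= (big_nth 0%N) !big_mkord /=.
  rewrite -[in (-1) ^+ _](card_ord (size b')) -prodrN /=.
  by apply: eq_bigr => i _; rewrite opprB natz.
move: inversion; rewrite h_val -dmu der prodE dimX /= exprS.
set s := (-1) ^+ \dim Z; set P := \prod_(_ <= _ < _) _; set N := #|_|%:R => sN.
apply: (@mulfI _ s); [by rewrite signr_eq0 | by apply: oppr_inj;
  rewrite mulrCA sN mulN1r mulNr].
Qed.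

(** * Parabolic subgroups, cores and supports *)

Lemma stabP X w : reflect {in X, forall x, act x w = x} (w \in pointwise_stab rG X).
Proof.
rewrite inE; apply: (iffP idP) => [/fixedSpacesP h x xX|h].
  by have := h x xX; rewrite lfunE.
by apply/fixedSpacesP => x xX; rewrite lfunE; apply: h.
Qed.

Lemma pointwise_stab_group_set X : group_set (pointwise_stab rG X).
Proof.
apply/group_setP; split=> [|w u /stabP hw /stabP hu]; apply/stabP => x xX.
  exact: act1.
by rewrite actM hw // hu.
Qed.
Canonical pointwise_stab_group X := Group (pointwise_stab_group_set X).

Lemma translate1 X : translate rG 1%g X = X.
Proof. by apply/vspaceP => x; rewrite translateP invg1 act1. Qed.

Lemma translateM w u X : translate rG (w * u)%g X = translate rG u (translate rG w X).
Proof. by apply/vspaceP => x; rewrite !translateP invMg actM. Qed.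

Lemma translateK w : cancel (translate rG w) (translate rG w^-1%g).
Proof. by move=> X; rewrite -translateM mulgV translate1. Qed.

Lemma translate_sub w X T : (translate rG w X <= translate rG w T)%VS = (X <= T)%VS.
Proof.
apply/subvP/subvP => h x xX; last by move: xX; rewrite !translateP; apply: h.
by have := h (act x w); rewrite !translateP actK; apply.
Qed.

Lemma setwise_stab_group_set X : group_set (setwise_stab rG X).
Proof.
apply/group_setP; split=> [|w u]; rewrite !inE ?translate1 // => /eqP hw /eqP hu.
by rewrite translateM hw hu.
Qed.
Canonical setwise_stab_group X := Group (setwise_stab_group_set X).

Lemma pointwise_sub_setwise X : pointwise_stab rG X \subset setwise_stab rG X.
Proof.
apply/subsetP => w wX;
  have /stabP hV : w^-1%g \in pointwise_stab rG X by rewrite groupV.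
rewrite inE; apply/eqP/vspaceP => x; rewrite translateP; apply/idP/idP => [h|xX].
  by rewrite -(actKV w x) (stabP _ _ wX).
by rewrite hV.
Qed.

Lemma orbitP X T : reflect (exists w, T = translate rG w X) (T \in orbit_flat rG X).
Proof.
apply: (iffP (imfsetP _ _ _ _)) => [[w _ ->]|[w ->]]; first by exists w.
by exists w => //=; rewrite inE.
Qed.

Lemma orbit_translate X T w : (translate rG w T \in orbit_flat rG X) = (T \in
  orbit_flat rG X).
Proof.
apply/orbitP/orbitP => [[u h]|[u ->]]; last by exists (u * w)%g; rewrite translateM.
by exists (u * w^-1)%g; rewrite translateM -h translateK.
Qed.

(** The elements carrying [T] to [X] form a coset of the setwise stabilizer. *)
Lemma card_transporter X T : T \in orbit_flat rG X ->
  #|[set w | translate rG w T == X]| = #|setwise_stab rG X|.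
Proof.
case/orbitP => u ->; rewrite -[RHS](card_imset _ (mulgI u^-1%g)).
apply: eq_card => w; rewrite !inE; apply/eqP/imsetP => [h|[v]].
  exists (u * w)%g; last by rewrite mulKg.
  by rewrite inE translateM h.
by rewrite inE => /eqP vX ->; rewrite -translateM mulKVg vX.
Qed.

Lemma stab_pt a v : (v \in pointwise_stab rG (sp a)) = (act (pt a) v == pt a).
Proof.
apply/stabP/eqP => [|h x]; first by apply; apply: pt_sp.
rewrite translateP => xa; apply: (can_inj (actK a.1^-1%g)).
have av : (a.1 * v * a.1^-1)%g \in parabolic a.2.
  by apply: stab_rho; rewrite !actM -/(pt a) h actK.
by rewrite -[RHS](parabolic_fix av xa) -!actM !mulgA mulVg mul1g.
Qed.

(** A face with span [X] is encoded by one pair for each element of the pointwise stabilizer of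
    [X]. *)
Lemma card_pairs X Z :
  #|[set a | (sp a == X) && bounded Z a]| =
    (#|pointwise_stab rG X| * #|[set d in faces | (sp d == X) && bounded Z d]|)%N.
Proof.
rewrite mulnC -sum_nat_const -sum1_card.
rewrite (partition_big (fun a => face_of (pt a))
  (mem [set d in faces | (sp d == X) && bounded Z d])) /=; last first.
  move=> a; rewrite inE => aP; have [ea _] := face_of_pt a.
  by rewrite inE face_of_faces (sp_pt ea) (bounded_pt _ ea).
apply: eq_bigr => d; rewrite inE => /and3P[dF /eqP spd bd].
have inj : injective (fun v => ((d.1 * v)%g, d.2)) by move=> v u [/mulgI].
rewrite -[RHS](card_imset _ inj) sum1dep_card; apply: eq_card => a; rewrite !inE.
apply/andP/imsetP => [[/andP[/eqP spa ba] /eqP ad]|[v]].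
  have [pa a2] := face_of_pt a; rewrite ad in pa a2.
  exists (d.1^-1 * a.1)%g; last by rewrite mulKVg a2; case: (a).
  by rewrite -spd stab_pt {1}/pt -actM mulKVg a2 pa.
rewrite -spd stab_pt => /eqP dv ->.
have e : pt ((d.1 * v)%g, d.2) = pt d by rewrite /pt /= actM.
rewrite (sp_pt e) (bounded_pt _ e) spd eqxx bd; split=> //; rewrite e.
by rewrite inE in dF.
Qed.

(** The reflections in the walls through a generic point of [T] fix [T], hence [X]; flatness of [T]
    concludes. *)
Lemma stab_sub_flat T X : isflat T ->
  pointwise_stab rG T \subset pointwise_stab rG X -> (X <= T)%VS.
Proof.
move=> fT /subsetP TX; apply/subvP => x xX; have [z zT gz] := generic T.
apply: fT zT _ => r rz; apply/eqP; rewrite -mem_wall.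
have /TX/stabP/(_ x xX) h : (gen r.2 ^ r.1^-1)%g \in pointwise_stab rG T.
  rewrite inE; apply/subvP => y yT; rewrite -/(wall r) mem_wall.
  by rewrite (gz _ rz).
by apply/fixedSpaceP; rewrite lfunE.
Qed.

Lemma stab_antimono T X : (X <= T)%VS -> pointwise_stab rG T \subset pointwise_stab
  rG X.
Proof. by move=> /subvP XT; apply/subsetP => w /stabP h; apply/stabP => x /XT/h. Qed.

Lemma stab_flat_inj T X : isflat T -> isflat X ->
  pointwise_stab rG T = pointwise_stab rG X -> T = X.
Proof.
move=> fT fX e; apply: subv_anti.
by rewrite !stab_sub_flat // e.
Qed.

Lemma parabolic_stab J : parabolic J = pointwise_stab rG (XJ J).
Proof.
apply/setP => w; apply/idP/stabP => [wJ x|h]; first exact: parabolic_fix.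
by apply: stab_rho; apply: h; apply/mem_XJ => i; rewrite phi_rho => /negPf->.
Qed.

Lemma sp1 J : sp (1%g, J) = XJ J.
Proof. exact: translate1. Qed.

Lemma isflat_XJ J : isflat (XJ J).
Proof. by rewrite -sp1; apply: isflat_sp. Qed.

Lemma omega_XJ j J : (omega j \in XJ J) = (j \in J).
Proof.
apply/mem_XJ/idP => [h|jJ i iJ].
  by apply/negPn/negP => /h/eqP; rewrite phi_omega eqxx oner_eq0.
by rewrite phi_omega; case: eqP => // ij; rewrite ij jJ in iJ.
Qed.

Lemma gen_stab i T : (gen i \in pointwise_stab rG T) = (T <= wall (1%g, i))%VS.
Proof. by rewrite inE /wall invg1 conjg1. Qed.

(** The complement of the core: [XJ (core_compl T)] is the least span of fundamental weights
    containing [T], by [sub_XJ]. *)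
Definition core_compl T : {set 'I_#|S|} := [set j | ~~ (T <= wall (1%g, j))%VS].

Lemma sub_XJ T J : (T <= XJ J)%VS = (core_compl T \subset J).
Proof.
apply/idP/idP => [TJ|/subsetP cJ].
  apply/subsetP => j; rewrite inE; apply: contraR => jJ; apply/subvP => x xT.
  by rewrite mem_wall /rt act1; apply/eqP; move: j jJ; apply/mem_XJ/(subvP TJ).
apply/subvP => x xT; apply/mem_XJ => i iJ.
have : i \notin core_compl T by apply: contra iJ; apply: cJ.
by rewrite inE negbK => /subvP/(_ x xT); rewrite mem_wall /rt act1 => /eqP.
Qed.

Lemma is_core_stab T I : is_core S (pointwise_stab rG T) I ->
  <<I>>%g = parabolic (core_compl T).
Proof.
case/and3P=> IS IT /forallP Imax; congr <<_>>%g; apply/eqP; rewrite eqEsubset.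
apply/andP; split.
  apply/subsetP => s sI; have [i si] := gen_surj (subsetP IS s sI); rewrite si.
  apply: imset_f; rewrite !inE negbK -gen_stab -si; apply: (subsetP IT).
  exact: mem_gen.
have := Imax [set gen i | i in ~: core_compl T];
  rewrite -/(parabolic _) parabolic_stab => /implyP; apply.
rewrite stab_antimono ?sub_XJ // andbT.
by apply/subsetP => s /imsetP[i _ ->]; apply: genP.
Qed.

Lemma ex_core T : is_core S (pointwise_stab rG T) [set gen i | i in ~: core_compl T].
Proof.
apply/and3P; split.
- by apply/subsetP => s /imsetP[i _ ->]; apply: genP.
- by rewrite -/(parabolic _) parabolic_stab stab_antimono // sub_XJ.
apply/forallP => K; apply/implyP => /andP[KS KT]; apply/subsetP => s sK.
have [i si] := gen_surj (subsetP KS s sK); rewrite si.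
by apply: imset_f; rewrite !inE negbK -gen_stab -si; apply/(subsetP KT)/mem_gen.
Qed.

(** [omega j] lies in [T] exactly when the stabilizer of [T] is inside the subgroup generated by the
    simple generators other than [gen j]. *)
Lemma is_support_stab T : isflat T ->
  is_support S (pointwise_stab rG T) S = [forall j, omega j \notin T].
Proof.
move=> fT; apply/and3P/forallP => [[_ _ /forallP h] j|h].
  apply/negP => jT; pose K := [set gen i | i in ~: [set j]].
  have KS : K \subset S by apply/subsetP => s /imsetP[i _ ->]; apply: genP.
  have := h K; rewrite KS -/(parabolic _) parabolic_stab stab_antimono /=; last first.
    apply/subvP => x xj;
      rewrite [x]omega_basis (bigD1 j) //= big1 ?addr0 ?memvZ // => i ij.
    by move/mem_XJ: xj => ->; rewrite ?scale0r ?inE.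
  move/subsetP/(_ _ (genP j))/imsetP => [i]; rewrite !inE => /negP ij /gen_inj ji.
  by apply: ij; rewrite ji.
split=> //; first by rewrite genW subsetT.
apply/forallP => K; apply/implyP => /andP[KS TK]; apply/subsetP => s sS.
have [j ->] := gen_surj sS; apply/negPn/negP => jK; have /negP := h j; apply.
suff /subvP : (XJ [set j] <= T)%VS by apply; rewrite omega_XJ inE.
apply: stab_sub_flat => //; apply: subset_trans TK _; rewrite -parabolic_stab.
apply: genS; apply/subsetP => t tK; have [i ti] := gen_surj (subsetP KS t tK).
rewrite ti; apply: imset_f; rewrite !inE; apply: contra jK => /eqP <-.
by rewrite -ti.
Qed.

(** * From subgroups to flats, and double counting *)

Lemma card_fset_pred (K : choiceType) (A : {fset K}) (P : pred K) :
  #|` [fset x in A | P x]%fset| = (\sum_(x <- A) P x)%N.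
Proof.
by rewrite card_fset_sum1 big_fset [LHS]big_mkcond /=; apply: eq_bigr => x _;
  case: (P x).
Qed.

(** A flat is determined by its pointwise stabilizer, so the subgroups can be counted through their
    flats. *)
Lemma full_support_with_coreE X Y : isflat X -> isflat Y ->
  #|full_support_with_core rG X Y| =
  #|` [fset Z in orbit_flat rG Y | (XJ (core_compl Z) \in orbit_flat rG X)
                                   && [forall j, omega j \notin Z]]%fset|.
Proof.
move=> fX fY;
  have fO (T Z : {vspace V}) : isflat T -> Z \in orbit_flat rG T -> isflat Z.
  by move=> fT /orbitP[w ->]; apply: isflat_translate.
set F := [fset Z in _ | _]%fset.
have memF Z : Z \in F -> isflat Z by rewrite !inE => /andP[/fO-/(_ fY)].
have injF : {in F &, injective (pointwise_stab rG)}.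
  by move=> Z Z' /memF fZ /memF fZ'; apply: stab_flat_inj.
rewrite -(card_in_imfset (p := mem F) imfset_key injF) /=.
rewrite cardE; apply: perm_size; apply: uniq_perm;
  rewrite ?enum_uniq ?fset_uniq // => W'.
rewrite mem_enum; apply/idP/imfsetP => [|[Z /= ZF ->]].
  rewrite inE => /and3P[/hasP[Z ZY /eqP->] sup /existsP[I /andP[coreI typI]]].
  have fZ := fO _ _ fY ZY.
  exists Z => //=; rewrite !inE ZY -is_support_stab // sup andbT /=.
  move: typI; rewrite (is_core_stab coreI) parabolic_stab => /hasP[X' X'X /eqP e].
  by rewrite (stab_flat_inj (@isflat_XJ _) (fO _ _ fX X'X) e).
have fZ := memF _ ZF; move: ZF; rewrite !inE => /and3P[ZY XO supZ].
apply/and3P; split; first by apply/hasP; exists Z.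
  by rewrite is_support_stab.
apply/existsP; exists [set gen i | i in ~: core_compl Z]; rewrite ex_core /=.
by rewrite -/(parabolic _) parabolic_stab; apply/hasP; exists (XJ (core_compl Z)).
Qed.

(** If [J] had an index [j] outside [core_compl Z], dimensions would force [Z = XJ (J :\ j)], which
    contains some [omega k] because [0 < \dim Z], against boundedness. *)
Lemma core_unique X Z J : \dim (XJ J) = (\dim Z).+1 -> (0 < \dim Z)%N ->
  (Z <= XJ J)%VS && bounded Z (1%g, J) =
  (J == core_compl Z) && [forall j, omega j \notin Z].
Proof.
rewrite dim_XJ => dJ Z_gt0; rewrite sub_XJ.
have bdE : bounded Z (1%g, J) = [forall j in J, omega j \notin Z].
  by apply: eq_forallb_in => j _; rewrite act1.
rewrite bdE; apply/andP/andP => [[cJ /forall_inP bd]|[/eqP-> /forallP h]]; last first.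
  by split=> //; apply/forall_inP => j _; apply: h.
have JE : J = core_compl Z.
  apply/eqP; rewrite eqEsubset cJ andbT; apply/subsetP => j jJ; apply: contraT => jc.
  have ZE : Z = XJ (J :\ j).
    apply/eqP; rewrite eqEdim dim_XJ sub_XJ subsetD1 cJ jc /=.
    by move: dJ; rewrite (cardsD1 j) jJ add1n => -[->].
  have /card_gt0P[k kJ] : (0 < #|J :\ j|)%N by rewrite -dim_XJ -ZE.
  by move: (kJ); rewrite inE => /andP[_ /bd]; rewrite ZE omega_XJ kJ.
split; first by rewrite -JE.
apply/forallP => j; case: (boolP (j \in J)) => [/bd //|jJ].
have ZJ : (Z <= XJ J)%VS by rewrite sub_XJ.
by apply: contra jJ => /(subvP ZJ); rewrite omega_XJ.
Qed.

(** Translation by [a.1] permutes the orbit of [Y]. *)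
Lemma sum_bounded_translate Y a :
  (\sum_(Z <- orbit_flat rG Y) ((Z <= sp a)%VS && bounded Z a) =
   \sum_(Z <- orbit_flat rG Y) ((Z <= XJ a.2)%VS && bounded Z (1%g, a.2)))%N.
Proof.
rewrite (perm_big [seq translate rG a.1 Z | Z <- orbit_flat rG Y]) /=.
  rewrite big_map; apply: eq_bigr => Z _; rewrite translate_sub;
    congr (nat_of_bool (_ && _)).
  by apply: eq_forallb_in => j _; rewrite translateP actK act1.
apply: uniq_perm; rewrite ?map_inj_uniq ?fset_uniq //.
  exact: (can_inj (translateK a.1)).
move=> T; apply/idP/mapP => [TY|[Z ZY ->]]; last by rewrite orbit_translate.
exists (translate rG a.1^-1 T); rewrite ?orbit_translate //.
by rewrite -{1}[a.1]invgK translateK.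
Qed.

(** Both sides count the pairs of an encoding [a] with span [X] and a flat [Z] of type [Y] in [X]
    with [bounded Z a]: on the left by the set [a.2] and the elements carrying its span to [X], on
    the right by [Z] and the face of [a]. *)
Lemma double_count X Y : isflat X -> isflat Y -> (0 < \dim Y)%N -> \dim X = (\dim
  Y).+1 ->
  (#|full_support_with_core rG X Y| * #|setwise_stab rG X| =
   #|pointwise_stab rG X| *
     \sum_(Z <- orbit_flat rG Y | (Z <= X)%VS)
        #|[set d in faces | (sp d == X) && bounded Z d]|)%N.
Proof.
move=> fX fY Y_gt0 dimXY; set OY := orbit_flat rG Y.
pose c J := (\sum_(Z <- OY) ((Z <= XJ J)%VS && bounded Z (1%g, J)))%N.
have dim_orbit T T' : T' \in orbit_flat rG T -> \dim T' = \dim T.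
  by case/orbitP => w ->; apply: dim_translate.
have -> : #|full_support_with_core rG X Y| =
    (\sum_(J : {set 'I_#|S|} | XJ J \in orbit_flat rG X) c J)%N.
  rewrite full_support_with_coreE // card_fset_pred exchange_big /=.
  apply: eq_big_seq => Z ZY.
  rewrite (eq_bigr (fun J => nat_of_bool ((J == core_compl Z) && [forall j, omega j
    \notin Z])));
    last first.
    move=> J JX; rewrite core_unique ?(dim_orbit _ _ ZY) //.
    by rewrite (dim_orbit _ _ JX) dimXY.
  have [cX|cX] := boolP (XJ (core_compl Z) \in _).
    by rewrite (bigD1 (core_compl Z)) //= eqxx big1 ?addn0 // => J /andP[_ /negPf->].
  by rewrite big1 // => J JX; case: eqP => // JE; rewrite -JE JX in cX.
transitivity (\sum_(a | sp a == X) c a.2)%N.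
  rewrite -(pair_big_dep predT (fun w J => translate rG w (XJ J) == X) (fun _ J => c
    J)) /=.
  rewrite [RHS](exchange_big_dep predT) //= big_distrl [LHS]big_mkcond /=.
  apply: eq_bigr => J _; rewrite sum_nat_cond_const mulnC.
  have [JX|JX] := boolP (XJ J \in _).
    by rewrite -(card_transporter JX) cardsE.
  rewrite eq_card0 // => w; rewrite inE; apply: contraNF JX => /eqP h.
  by apply/orbitP; exists w^-1%g; rewrite -h translateK.
transitivity (\sum_(a | sp a == X) \sum_(Z <- OY) ((Z <= sp a)%VS && bounded Z a))%N.
  by apply: eq_bigr => a _; rewrite sum_bounded_translate.
rewrite exchange_big /= big_distrr [RHS]big_mkcond /=; apply: eq_bigr => Z _.
rewrite -card_pairs -sum1_card; case: ifPn => ZX.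
  rewrite [RHS]big_mkcond [LHS]big_mkcond /=; apply: eq_bigr => a _; rewrite inE.
  by case: eqP => //= ->; rewrite ZX.
by rewrite big1 // => a /eqP->; rewrite (negPf ZX).
Qed.

End CoxeterGeometry.

(** For [\dim Y] = 0 the only subgroup of type [Y] is the whole group, whose core has type 0 and not
    [X], while the right side is positive; hence the assumption [0 < \dim Y]. *)
Theorem theorem3p7 (R : realType) (gT : finGroupType) (S : {set gT})
    (rG : mx_representation R [set: gT] #|S|)
    (X Y : {vspace 'rV[R]_#|S|}) (b : seq nat) :
  coxeter_system S ->
  irreducible_coxeter S ->
  geometric_representation rG ->
  X \in flats rG ->
  Y \in flats rG ->
  \dim X = (\dim Y).+1 ->
  (0 < \dim Y)%N ->
  orlik_solomon_exponents rG X b ->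
  #|full_support_with_core rG X Y|%:R =
    (2 * (orlik_solomon_number rG X Y)%:R)
      / #|setwise_stab rG X : pointwise_stab rG X|%g%:R
      * \prod_(1 <= i < \dim X) ((nth 0%N b i)%:R - 1) :> rat.
Proof.
case=> genW invS _ _ geo XF YF dimXY Y_gt0 expX.
have fX : isflat rG X by apply: isflat_flats XF.
have fY : isflat rG Y by apply: isflat_flats YF.
have count := double_count genW invS geo fX fY Y_gt0 dimXY.
set total := (\sum_(Z <- _ | _) _)%N in count.
pose P : int := \prod_(1 <= i < \dim X) ((nth 0%N b i)%:R - 1).
(* Every [Z] of type [Y] in [X] contributes the same number of faces. *)
have totalE : total%:R = 2 * P * (orlik_solomon_number rG X Y)%:R :> int.
  rewrite /orlik_solomon_number card_fset_pred !natr_sum mulr_sumr big_mkcond.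
  apply: eq_big_seq => Z /orbitP[w ZE]; case: ifP => ZX; last by rewrite mulr0.
  rewrite mulr1 (count_bounded genW invS geo fX _ ZX _ expX) //.
    by rewrite ZE; apply: isflat_translate.
  by rewrite ZE dim_translate.
have lagrange := Lagrange (pointwise_sub_setwise rG X).
have W_gt0 := cardG_gt0 (pointwise_stab_group rG X).
have idx_gt0 := indexg_gt0 (setwise_stab_group rG X) (pointwise_stab_group rG X).
rewrite /= in lagrange W_gt0 idx_gt0.
set idx := #|_ : _|%g in lagrange idx_gt0 *.
(* Lagrange's theorem cancels the order of the pointwise stabilizer from the double count. *)
have GE : (#|full_support_with_core rG X Y| * idx)%N = total.
  apply/eqP; rewrite -(eqn_pmul2l W_gt0) mulnCA lagrange; exact/eqP.
have -> : \prod_(1 <= i < \dim X) ((nth 0%N b i)%:R - 1) = P%:~R :> rat.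
  by rewrite rmorph_prod; apply: eq_bigr => i _; rewrite rmorphB rmorph_nat.
have idx0 : idx%:R != 0 :> rat by rewrite pnatr_eq0 -lt0n.
apply: (mulIf idx0); rewrite -[LHS]natrM GE mulrAC divfK //.
have := congr1 (fun z : int => z%:~R : rat) totalE; rewrite !rmorphM !rmorph_nat => ->.
by rewrite mulrAC.
Qed.
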